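(* Let $p=md$ and let $$\mathcal{X}=\bigcup_{i=1}^m\{x\in\mathbb{R}^{md}: x \text{ has all coordinates zero outside the block of indices } (i-1)d+1,\dots,id\},$$ i.e. the union of the $m$ coordinate blocks $\{0_d\}\times\cdots\times\mathbb{R}^d\times\cdots\times\{0_d\}$. For $i=1,\dots,m$ let $T_i:\mathcal{X}\to\mathbb{R}^d$ be the projection onto coordinates $(i-1)d+1,\dots,id$. Let $H_n$ be generated by the adaptive linear Gaussian sampling procedure with a fixed sampling rule $\Lambda$, known variance $\sigma^2>0$ and true parameter $\beta_0\in\mathbb{R}^p$, and let $I_{n,i}=\sum_{j=1}^n T_i(x_j)T_i(x_j)^\top\in\mathbb{R}^{d\times d}$. Assume: (i) each $x_j\in\mathcal{X}$; (ii) for every $i=1,\dots,m$, $\lambda_{\min}(I_{n,i})\xrightarrow{p}\infty$ and $\log\lambda_{\max}(I_{n,i})=o_p(\lambda_{\min}(I_{n,i}))$; (iii) the prior $\pi$ is a continuous, bounded density on $\mathbb{R}^p$ with $\pi(\beta_0)>0$. Then, with $\hat\beta_n=(\mathbf{X}_n^\top\mathbf{X}_n)^{-1}\mathbf{X}_n^\top\mathbf{y}_n$, $$\big\|\pi(\cdot\mid H_n)-\mathcal{N}\big(\hat\beta_n,\sigma^2(\mathbf{X}_n^\top\mathbf{X}_n)^{-1}\big)\big\|_{\mathrm{TV}}\xrightarrow{p}0.$$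
   Context: Adaptive linear Gaussian sampling procedure: given a covariate sampling rule $\Lambda$ mapping any finite history $H_{j-1}=((x_1,y_1),\dots,(x_{j-1},y_{j-1}))$ to a probability distribution $\Lambda(\cdot\mid H_{j-1})$ on $\mathbb{R}^p$, set $H_0=\emptyset$ and for $j=1,\dots,n$: draw $x_j\sim\Lambda(\cdot\mid H_{j-1})$, then $y_j\sim\mathcal{N}(x_j^\top\beta_0,\sigma^2)$ conditionally on the past and $x_j$, and set $H_j=((x_1,y_1),\dots,(x_j,y_j))$. $\mathbf{X}_n$ is the $n\times p$ matrix with rows $x_j^\top$, $\mathbf{y}_n$ the vector of $y_j$, and $\pi(\beta\mid H_n)\propto\pi(\beta)\prod_{j=1}^n\exp(-(y_j-x_j^\top\beta)^2/(2\sigma^2))$. (This models a linear contextual bandit with $m$ arms and $d$-dimensional contexts, $\beta_0$ being the vertical stacking of per-arm parameter vectors.) $\lambda_{\min},\lambda_{\max}$ are extreme eigenvalues; $\|\cdot\|_{\mathrm{TV}}$ is total variation distance. *)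

(* Defs.v *)
From HB Require Import structures.
From mathcomp Require Import all_boot all_order all_algebra.
From mathcomp Require Import all_classical all_reals all_analysis.
Set Implicit Arguments. Unset Strict Implicit. Unset Printing Implicit Defensive.
Import Order.TTheory GRing.Theory Num.Theory.
Import numFieldNormedType.Exports.
Local Open Scope classical_set_scope.
Local Open Scope ring_scope.

(* Points of R^p are represented, for measure-theoretic purposes, as
   p.-tuples of reals (product sigma-algebra = Borel sigma-algebra of R^p),
   and, for linear algebra / topology, as column vectors 'cV[R]_p. *)
Definition tcol (R : realType) (p : nat) (t : p.-tuple R) : 'cV[R]_p :=
  \col_i tnth t i.

(* Iterated Lebesgue integral over R^n (= integral w.r.t. n-dimensional
   Lebesgue measure, by Tonelli, for the nonnegative integrands used here). *)
Fixpoint lebint (R : realType) (n : nat) : (n.-tuple R -> \bar R) -> \bar R :=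
  match n return (n.-tuple R -> \bar R) -> \bar R with
  | 0 => fun F => F [tuple]
  | n'.+1 => fun F =>
      (\int[@lebesgue_measure R]_x lebint (fun t : n'.-tuple R => F [tuple of x :: t]))%E
  end.

Definition hist (R : realType) (p j : nat) := j.-tuple (p.-tuple R * R)%type.

Definition sampling_rule (R : realType) (p : nat) :=
  forall j : nat, R.-pker (hist R p j) ~> (p.-tuple R).

Definition dotv (R : realType) (p : nat) (x : p.-tuple R) (b : 'cV[R]_p) : R :=
  ((tcol x)^T *m b) 0 0.

(* hexp Lam b0 s k j h F : expectation of F(H_{j+k}) when the adaptive linear
   Gaussian procedure (rule Lam, true parameter b0, noise std s) is run for k
   more steps starting from the history h of length j. *)
Fixpoint hexp (R : realType) (p : nat) (Lam : sampling_rule R p) (b0 : 'cV[R]_p)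
    (s : R) (k : nat) : forall j : nat, hist R p j ->
      (seq (p.-tuple R * R) -> \bar R) -> \bar R :=
  match k with
  | 0 => fun j h F => F (tval h)
  | k'.+1 => fun j h F =>
      (\int[Lam j h]_x \int[normal_prob (dotv x b0) s]_y
          hexp Lam b0 s k' [tuple of rcons h (x, y)] F)%E
  end.

Definition hprob (R : realType) (p : nat) (Lam : sampling_rule R p)
    (b0 : 'cV[R]_p) (s : R) (n : nat) (E : set (seq (p.-tuple R * R))) : \bar R :=
  hexp Lam b0 s n [tuple] (fun h => (\1_E h)%:E).

Definition vanishing_prob (R : realType) (p : nat) (Lam : sampling_rule R p)
    (b0 : 'cV[R]_p) (s : R) (E : nat -> set (seq (p.-tuple R * R))) : Prop :=
  (fun n => hprob Lam b0 s n (E n)) @ \oo --> 0%E.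

Definition Xmat (R : realType) (p : nat) (h : seq (p.-tuple R * R)) : 'M[R]_(size h, p) :=
  \matrix_(j, k) tnth (tnth (in_tuple h) j).1 k.
Definition yvec (R : realType) (p : nat) (h : seq (p.-tuple R * R)) : 'cV[R]_(size h) :=
  \col_j (tnth (in_tuple h) j).2.

Definition in_blocks (R : realType) (m d : nat) (x : (m * d).-tuple R) : Prop :=
  exists i : 'I_m, forall k : 'I_(m * d), (k %/ d)%N != i -> tnth x k = 0.

(* T_i : projection onto the coordinates of block i (0-based i). *)
Definition Tproj (R : realType) (m d : nat) (i : 'I_m) (x : (m * d).-tuple R) : 'cV[R]_d :=
  \col_k tnth x (mxvec_index i k).

Definition Iblock (R : realType) (m d : nat) (i : 'I_m)
    (h : seq ((m * d).-tuple R * R)) : 'M[R]_d :=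
  \sum_(z <- h) (Tproj i z.1 *m (Tproj i z.1)^T).

Definition lambda_min (R : realType) (d : nat) (A : 'M[R]_d) : R :=
  inf [set a : R | eigenvalue A a].
Definition lambda_max (R : realType) (d : nat) (A : 'M[R]_d) : R :=
  sup [set a : R | eigenvalue A a].

Definition lik (R : realType) (p : nat) (s : R) (h : seq (p.-tuple R * R)) (b : 'cV[R]_p) : R :=
  \prod_(z <- h) expR (- (z.2 - dotv z.1 b) ^+ 2 / (2 * s ^+ 2)).

Definition posterior (R : realType) (p : nat) (prior : 'cV[R]_p -> R) (s : R)
    (h : seq (p.-tuple R * R)) (b : 'cV[R]_p) : R :=
  prior b * lik s h b /
    fine (lebint (fun t => (prior (tcol t) * lik s h (tcol t))%:E)).

Definition mvn_pdf (R : realType) (p : nat) (mu : 'cV[R]_p) (S : 'M[R]_p)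
    (b : 'cV[R]_p) : R :=
  (Num.sqrt ((2 * pi) ^+ p * \det S))^-1 *
  expR (- (((b - mu)^T *m invmx S *m (b - mu)) 0 0) / 2).

Definition ols (R : realType) (p : nat) (h : seq (p.-tuple R * R)) : 'cV[R]_p :=
  invmx ((Xmat h)^T *m Xmat h) *m ((Xmat h)^T *m yvec h).

Definition tvdist (R : realType) (p : nat) (f g : 'cV[R]_p -> R) : \bar R :=
  ereal_sup [set `| lebint (fun t => (\1_A t * f (tcol t))%:E)
                   - lebint (fun t => (\1_A t * g (tcol t))%:E) |%E
            | A in [set A : set (p.-tuple R) | measurable A]].

(* Main.v *)
(** The posterior is the law with density proportional to [prior * g], where [g] is
    the Gaussian density centred at the least squares estimator.  Its total variation
    distance to [g] is controlled by the integral of [|prior - prior beta0| * g], which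
    is small as soon as [g] concentrates near [beta0], i.e. as soon as [lambda_min] of
    the Gram matrix is large and the least squares estimator is close to [beta0].

    Consistency of the estimator is a self-normalized bound obtained by the method of
    mixtures, one block at a time: averaging the likelihood ratios
    [lik (beta0 + u) / lik beta0] over a Gaussian [u] supported by block [i] gives a
    martingale of constant mean.  If the error [theta] of block [i] were large, this
    average would be at least of order
    [exp (lambda_min |theta|^2 / (4 sigma^2)) * lambda_max ^ (- d / 2)], which tends to
    infinity since [ln lambda_max = o(lambda_min)]; Markov's inequality rules this out.

    Integrals against the history are lower integrals on nonmeasurable events: they
    are always monotone, but additive only on measurable functions.  So the final
    event is bounded pointwise by a sum of measurable functions before integrating. *)
Require Import Defs.
From HB Require Import structures.
From mathcomp Require Import all_boot all_order all_algebra.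
From mathcomp Require Import all_classical all_reals all_analysis measurable_realfun.
From mathcomp Require Import lra.
Import Order.TTheory GRing.Theory Num.Theory.
Import numFieldNormedType.Exports.
Local Open Scope classical_set_scope.
Local Open Scope ring_scope.
Set Implicit Arguments. Unset Strict Implicit. Unset Printing Implicit Defensive.

(** * Iterated Lebesgue integrals *)

Section cons_measure.
Context (R : realType) (n : nat).
Variable lam : {sigma_finite_measure set (measurableTypeR R) -> \bar R}.
Variable mu : {sigma_finite_measure set (n.-tuple R) -> \bar R}.

Definition tcons (z : measurableTypeR R * n.-tuple R) : n.+1.-tuple R := [tuple of z.1 :: z.2].

Lemma measurable_tcons : measurable_fun setT tcons.
Proof. exact: measurable_cons. Qed.

Definition cons_measure : set (n.+1.-tuple R) -> \bar R :=
  pushforward (lam \x mu)%E tcons.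

Let cons_measure0 : cons_measure set0 = 0%E.
Proof. by rewrite /cons_measure /pushforward preimage_set0 measure0. Qed.

Let cons_measure_ge0 A : (0 <= cons_measure A)%E.
Proof. by rewrite /cons_measure /pushforward measure_ge0. Qed.

Let cons_measure_sigma_additive : semi_sigma_additive cons_measure.
Proof.
move=> F mF tF mUF; rewrite /cons_measure /pushforward preimage_bigcup.
apply: measure_semi_sigma_additive.
- by move=> k; rewrite -[X in measurable X]setTI; exact: measurable_tcons.
- apply/trivIsetP => /= i j _ _ ij; rewrite -preimage_setI.
  by move/trivIsetP : tF => /(_ _ _ _ _ ij) ->//; rewrite preimage_set0.
- by rewrite -preimage_bigcup -[X in measurable X]setTI; exact: measurable_tcons.
Qed.

HB.instance Definition _ := isMeasure.Build _ _ _ cons_measure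
  cons_measure0 cons_measure_ge0 cons_measure_sigma_additive.

(** Rectangles [F k] x [G k] are pulled back along the inverse [g] of [tcons]. Both exhausting
    sequences are nondecreasing, so the index [maxn k l] serves the two coordinates at once. *)
Lemma cons_measure_sigma_finite : sigma_finite setT cons_measure.
Proof.
have /sigma_finiteP[F [TF ndF Foo]] := sigma_finiteT lam.
have /sigma_finiteP[G [TG ndG Goo]] := sigma_finiteT mu.
pose g (t : n.+1.-tuple R) : measurableTypeR R * n.-tuple R := (thead t, [tuple of behead t]).
have gK : cancel tcons g.
  by move=> [x t]; rewrite /g /tcons/= theadE; congr pair; apply: val_inj.
have mg : measurable_fun setT g.
  apply/measurable_fun_pairP; split => /=.
    exact: measurable_tnth.
  exact: measurable_behead.
exists (fun k => g @^-1` (F k `*` G k)).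
  rewrite -preimage_bigcup; apply/seteqP; split => // t _ /=.
  have [k _ Fk] : (\bigcup_k F k) (g t).1 by rewrite -TF.
  have [l _ Gl] : (\bigcup_k G k) (g t).2 by rewrite -TG.
  exists (maxn k l) => //; split.
  - by move: Fk; apply/subsetPset/ndF/leq_maxl.
  - by move: Gl; apply/subsetPset/ndG/leq_maxr.
move=> k; have [mF Fk] := Foo k; have [mG Gk] := Goo k; split.
  by rewrite -[X in measurable X]setTI; apply: mg => //; exact: measurableX.
rewrite /cons_measure /pushforward.
rewrite (_ : _ @^-1` _ = F k `*` G k); last first.
  by apply/seteqP; split => z; rewrite /preimage /mkset gK.
by rewrite product_measure1E// lte_mul_pinfty// ge0_fin_numE.
Qed.

HB.instance Definition _ :=
  Measure_isSigmaFinite.Build _ _ _ cons_measure cons_measure_sigma_finite.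

End cons_measure.

(** Turns the nested integrals into one integral, for which linearity and Tonelli are available. The
    induction starts from the Dirac mass at the empty tuple; each step is Tonelli, which is why
    sigma-finiteness is carried along. *)
Lemma lebint_measure (R : realType) (n : nat) :
  exists mu : {sigma_finite_measure set (n.-tuple R) -> \bar R},
    forall F : n.-tuple R -> \bar R, (forall t, 0 <= F t)%E ->
      measurable_fun [set: n.-tuple R] F -> lebint F = (\int[mu]_t F t)%E.
Proof.
elim: n => [|n [mu muE]].
  exists (@dirac _ _ [tuple] R) => F F0 mF /=.
  by rewrite integral_dirac// diracT mul1e.
exists (@cons_measure R n (@lebesgue_measure R) mu) => F F0 mF /=.
rewrite /cons_measure ge0_integral_pushforward//=; last exact: measurable_tcons.
rewrite preimage_setT fubini_tonelli1//=; last first.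
  by apply: measurableT_comp => //; exact: measurable_tcons.
apply: eq_integral => x _; rewrite muE//.
apply: (measurableT_comp mF) => /=.
exact: (measurable_cons (f := fun=> x)).
Qed.

(** * Gaussian integrals *)

Definition qform (R : pzSemiRingType) (n : nat) (A : 'M[R]_n) (v : 'cV[R]_n) : R :=
  (v^T *m A *m v) 0 0.

Definition posdef (R : realType) (n : nat) (A : 'M[R]_n) : Prop :=
  A^T = A /\ forall v : 'cV[R]_n, v != 0 -> 0 < qform A v.

Lemma qformE (R : pzSemiRingType) (n : nat) (A : 'M[R]_n) (v : 'cV[R]_n) :
  qform A v = \sum_j (\sum_i v i 0 * A i j) * v j 0.
Proof.
rewrite /qform mxE; apply: eq_bigr => j _; rewrite mxE; congr (_ * _).
by apply: eq_bigr => i _; rewrite mxE.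
Qed.

Lemma posdef_det_neq0 (R : realType) (n : nat) (A : 'M[R]_n) :
  posdef A -> \det A != 0.
Proof.
move=> [As Ap]; apply/det0P => -[v v0 vA0].
have := Ap v^T; rewrite trmx_eq0 v0 => /(_ isT).
by rewrite /qform trmxK vA0 mul0mx mxE ltxx.
Qed.

Lemma posdef_unitmx (R : realType) (n : nat) (A : 'M[R]_n) :
  posdef A -> A \in unitmx.
Proof. by move=> /posdef_det_neq0; rewrite unitmxE unitfE. Qed.

Lemma mx11_trmx (R : Type) (M : 'M[R]_1) : M^T = M.
Proof. by apply/matrixP => i j; rewrite !mxE !ord1. Qed.

(** * Splitting off the first coordinate by a Schur complement *)

Section schur.
Variables (R : realType) (n : nat) (A : 'M[R]_(1 + n)).
Hypothesis pdA : posdef A.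
Let C := drsubmx A.
Let c := dlsubmx A.

Definition schur_compl : R := A 0 0 - (c^T *m invmx C *m c) 0 0.

Let Aur : ursubmx A = c^T.
Proof. by rewrite /c trmx_dlsub; case: pdA => ->. Qed.

Let Csym : C^T = C.
Proof. by rewrite /C trmx_drsub; case: pdA => ->. Qed.

Let Aul : ulsubmx A = (A 0 0)%:M.
Proof.
rewrite [LHS]mx11_scalar; congr (_%:M); rewrite !mxE; congr (A _ _); exact: val_inj.
Qed.

Let qform_block (z : R) (w : 'cV[R]_n) :
  qform A (col_mx z%:M w) = A 0 0 * z ^+ 2 + (w^T *m c) 0 0 * z *+ 2 + qform C w.
Proof.
rewrite /qform -[A in LHS]submxK Aul Aur -/C -/c tr_col_mx tr_scalar_mx.
rewrite mul_row_block mul_row_col !mulmxDl !mul_scalar_mx !mul_mx_scalar.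
rewrite -scalemxAl ![in LHS]mxE/=.
have E : \sum_j c^T 0 j * w j 0 = \sum_j w^T 0 j * c j 0.
  by apply: eq_bigr => j _; rewrite !mxE mulrC.
rewrite E [(w^T *m c) 0 0]mxE [(w^T *m C *m w) 0 0]mxE; lra.
Qed.

Lemma posdef_drsub : posdef C.
Proof.
split=> // v v0; have := pdA.2 (col_mx 0 v).
rewrite -(scale0r (1%:M : 'M[R]_1)) scalemx1 qform_block expr0n !mulr0 mul0rn !add0r.
apply; apply: contra v0 => /eqP E; apply/eqP.
by have := congr1 dsubmx E; rewrite col_mxKd => ->; rewrite linear0.
Qed.

Let Cu : C \in unitmx := posdef_unitmx posdef_drsub.

(** Completion of the square in [w] for fixed [z]. *)
Lemma qform_schur (z : R) (w : 'cV[R]_n) : qform A (col_mx z%:M w) =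
  schur_compl * z ^+ 2 + qform C (w + z *: (invmx C *m c)).
Proof.
rewrite qform_block /schur_compl.
set k := invmx C *m c.
have Ck : C *m k = c by rewrite /k mulKVmx.
have kC : k^T *m C = c^T by rewrite -[in RHS]Ck [RHS]trmx_mul Csym.
have -> : c^T *m invmx C *m c = c^T *m k by rewrite -mulmxA.
have tk : (w + z *: k)^T = w^T + z *: k^T by rewrite linearD/= linearZ.
clearbody k; rewrite /qform tk !mulmxDl !mulmxDr -!scalemxAl -!scalemxAr.
rewrite kC -(mulmxA w^T C k) Ck.
rewrite !mxE.
have -> : \sum_j c^T 0 j * w j 0 = \sum_j w^T 0 j * c j 0.
  by apply: eq_bigr => j _; rewrite !mxE mulrC.
by lra.
Qed.

(** It is the value of the form at the vector with first coordinate 1 whose remaining part cancels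
    the completed square. *)
Lemma schur_compl_gt0 : 0 < schur_compl.
Proof.
have := pdA.2 (col_mx 1%:M (- (invmx C *m c))).
rewrite qform_schur scale1r addNr expr1n mulr1 /qform mulmx0 mxE addr0; apply.
apply/eqP => E; have := congr1 usubmx E.
rewrite col_mxKu linear0 => /matrixP/(_ 0 0); rewrite !mxE/=.
by move/eqP; rewrite oner_eq0.
Qed.

Lemma det_schur : \det A = schur_compl * \det C.
Proof.
have -> : A = block_mx 1%:M (c^T *m invmx C) 0 1%:M *m
              block_mx (schur_compl)%:M 0 c C.
  rewrite mulmx_block !mul1mx !mul0mx !add0r mulmxKV//.
  rewrite -[LHS]submxK Aur Aul; congr block_mx.
  rewrite [X in _ = _ + X]mx11_scalar -!mulmxA.
  by rewrite -raddfD/= /schur_compl !mulmxA subrK.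
by rewrite det_mulmx det_ublock det_lblock !det1 !mul1r det_scalar1.
Qed.

End schur.

Lemma posdef_det_gt0 (R : realType) (n : nat) (A : 'M[R]_n) :
  posdef A -> 0 < \det A.
Proof.
elim: n A => [|n IH] A pdA; first by rewrite det_mx00.
by rewrite (@det_schur R n A pdA) mulr_gt0 ?schur_compl_gt0 ?IH//; exact: posdef_drsub.
Qed.

Lemma tcol_cons (R : realType) (n : nat) (x : R) (t : n.-tuple R) :
  tcol [tuple of x :: t] = col_mx x%:M (tcol t) :> 'cV[R]_(1 + n).
Proof.
apply/matrixP => i j; rewrite !mxE ord1.
case: splitP => k ki; rewrite !mxE.
  rewrite ord1 eqxx mulr1n; have -> : i = ord0 by apply: val_inj; rewrite /= ki ord1.
  by rewrite tnth0.
have -> : i = lift ord0 k by apply: val_inj; rewrite /= ki.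
by rewrite tnthS.
Qed.

(** Up to its peak, the integrand is the normal density of standard deviation [s], the inverse
    square root of [a], whose total mass is 1. *)
Lemma integral_gauss (R : realType) (a mu : R) : 0 < a ->
  (\int[@lebesgue_measure R]_x (expR (- (a * (x - mu) ^+ 2) / 2))%:E)%E =
  (Num.sqrt (2 * pi / a))%:E.
Proof.
move=> a0; pose s := (Num.sqrt a)^-1.
have s0 : s != 0 by rewrite invr_eq0 gt_eqF// sqrtr_gt0.
have s2 : s ^+ 2 = a^-1 by rewrite exprVn sqr_sqrtr// ltW.
have pk : normal_peak s != 0 by rewrite gt_eqF// normal_peak_gt0.
have -> : Num.sqrt (2 * pi / a) = (normal_peak s)^-1.
  rewrite /normal_peak invrK s2; congr Num.sqrt; rewrite -mulr_natl; lra.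
rewrite -[RHS]mule1 -(integral_normal_pdf mu s) -ge0_integralZl//; last 3 first.
- by apply/measurable_EFinP; exact: measurable_normal_pdf.
- by move=> x _; rewrite lee_fin normal_pdf_ge0.
- by rewrite lee_fin invr_ge0 normal_peak_ge0.
apply: eq_integral => x _; rewrite normal_pdfE// -EFinM mulKf//.
by congr (expR _)%:E; rewrite s2 -(mulr_natr a^-1) invfM invrK; lra.
Qed.

Lemma measurable_qform (R : realType) (d : measure_display) (T : measurableType d)
    (n : nat) (A : T -> 'M[R]_n) (v : T -> 'cV[R]_n) :
  (forall i j, measurable_fun setT (fun t => A t i j)) ->
  (forall i, measurable_fun setT (fun t => v t i 0)) ->
  measurable_fun setT (fun t => qform (A t) (v t)).
Proof.
move=> mA mv; under eq_fun do rewrite qformE.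
apply: measurable_sum => j; apply: measurable_funM => //.
by apply: measurable_sum => i; exact: measurable_funM.
Qed.

Lemma measurable_tcol (R : realType) (n : nat) (mu : 'cV[R]_n) (i : 'I_n) :
  measurable_fun setT (fun t : n.-tuple R => (tcol t - mu) i 0).
Proof.
under eq_fun do rewrite !mxE.
by apply: measurable_funB => //; exact: measurable_tnth.
Qed.

(** Induction on the dimension: once the square is completed, the integral over the last [n]
    coordinates is a constant, the first coordinate gives a one-dimensional Gaussian integral, and
    [det_schur] recombines the determinants. *)
Lemma lebint_gauss (R : realType) (n : nat) (A : 'M[R]_n) (mu : 'cV[R]_n) :
  posdef A ->
  lebint (fun t => (expR (- qform A (tcol t - mu) / 2))%:E) =
  (Num.sqrt ((2 * pi) ^+ n / \det A))%:E.
Proof.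
elim: n A mu => [|n IH] A mu pdA /=.
  rewrite det_mx00 expr0 divr1 sqrtr1 /qform.
  by rewrite [_ - mu]flatmx0 mulmx0 mxE oppr0 mul0r expR0.
pose C := drsubmx (A : 'M[R]_(1 + n)); pose c := dlsubmx (A : 'M[R]_(1 + n)).
have pdC : posdef C by exact: posdef_drsub.
have s0 := schur_compl_gt0 pdA.
set s := schur_compl _ in s0.
pose mu0 := (usubmx (mu : 'cV[R]_(1 + n))) 0 0; pose mu1 := dsubmx (mu : 'cV[R]_(1 + n)).
have [lam lamE] := lebint_measure R n.
have K0 : 0 <= Num.sqrt ((2 * pi) ^+ n / \det C) by exact: sqrtr_ge0.
transitivity ((\int[@lebesgue_measure R]_x
    ((expR (- (s * (x - mu0) ^+ 2) / 2))%:E * (Num.sqrt ((2 * pi) ^+ n / \det C))%:E))%E).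
  apply: eq_integral => x _.
  (* This centre produces the completed square of [qform_schur]; the value given by [IH] depends
     neither on the centre nor, therefore, on [x]. *)
  rewrite -(IH C (mu1 - (x - mu0) *: (invmx C *m c)) pdC).
  have m1 nu : measurable_fun [set: n.-tuple R]
      (fun t => (expR (- qform C (tcol t - nu) / 2))%:E).
    apply/measurable_EFinP/measurableT_comp => //.
    apply: measurable_funM => //; apply: measurableT_comp => //.
    by apply: measurable_qform => //= i; exact: measurable_tcol.
  have m2 : measurable_fun [set: n.-tuple R]
      (fun t => (expR (- qform A (tcol [tuple of x :: t] - mu) / 2))%:E).
    apply/measurable_EFinP/measurableT_comp => //.
    apply: measurable_funM => //; apply: measurableT_comp => //.
    apply: measurable_qform => //= i; under eq_fun do rewrite !mxE.
    apply: measurable_funB => //.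
    apply: (@measurableT_comp _ _ _ _ _ _ (fun t : n.+1.-tuple R => tnth t i)).
      exact: measurable_tnth.
    exact: (measurable_cons (f := fun=> x)).
  have e0 (f : n.-tuple R -> R) t : (0 <= (expR (f t))%:E)%E.
    by rewrite lee_fin expR_ge0.
  rewrite lamE// lamE// -ge0_integralZl//.
  apply: eq_integral => t _; rewrite -EFinM -expRD; congr (expR _)%:E.
  rewrite -mulrDl -opprD; congr (- _ / _).
  have -> : tcol [tuple of x :: t] - mu =
      col_mx (x - mu0)%:M (tcol t - mu1) :> 'cV[R]_(1 + n).
    transitivity (col_mx x%:M (tcol t) -
        col_mx (usubmx (mu : 'cV[R]_(1 + n))) mu1); first by rewrite vsubmxK -tcol_cons.
    by rewrite opp_col_mx add_col_mx raddfB/= -mx11_scalar.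
  rewrite (qform_schur pdA); congr (_ + qform _ _).
  by rewrite opprB addrA addrAC.
have m3 : measurable_fun [set: R] (fun x => (expR (- (s * (x - mu0) ^+ 2) / 2))%:E).
  apply/measurable_EFinP/measurableT_comp => //.
  apply: measurable_funM => //; apply: measurableT_comp => //.
  by apply: measurable_funM => //; apply: measurable_funX; exact: measurable_funB.
rewrite ge0_integralZr//.
rewrite integral_gauss// -EFinM -sqrtrM ?divr_ge0 ?mulr_ge0 ?pi_ge0 ?ltW//.
congr (Num.sqrt _)%:E; rewrite (det_schur pdA) -/s -/C exprS.
by rewrite invfM; lra.
Qed.

(** * Extreme eigenvalues *)

Definition sqn (R : pzSemiRingType) (n : nat) (v : 'cV[R]_n) : R := qform 1%:M v.

Lemma sqnE (R : pzSemiRingType) (n : nat) (v : 'cV[R]_n) : sqn v = \sum_i v i 0 ^+ 2.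
Proof. by rewrite /sqn /qform mulmx1 mxE; apply: eq_bigr => i _; rewrite !mxE expr2. Qed.

Lemma sqn_ge0 (R : realType) (n : nat) (v : 'cV[R]_n) : 0 <= sqn v.
Proof. by rewrite sqnE sumr_ge0// => i _; exact: sqr_ge0. Qed.

Lemma sqn_eq0 (R : realType) (n : nat) (v : 'cV[R]_n) : (sqn v == 0) = (v == 0).
Proof.
apply/eqP/eqP => [v0|->]; last by rewrite /sqn /qform mulmx0 mxE.
apply/matrixP => i j; rewrite mxE ord1; apply/eqP; rewrite -sqrf_eq0; apply/eqP.
have := v0; rewrite sqnE => /eqP; rewrite psumr_eq0; last by move=> k _; exact: sqr_ge0.
by move=> /allP/(_ i); rewrite mem_index_enum => /(_ isT) /= /eqP.
Qed.

Lemma sqn_gt0 (R : realType) (n : nat) (v : 'cV[R]_n) : (0 < sqn v) = (v != 0).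
Proof. by rewrite lt_neqAle sqn_ge0 andbT eq_sym sqn_eq0. Qed.

Lemma qformZ (R : comPzRingType) (n : nat) (A : 'M[R]_n) (a : R) (v : 'cV[R]_n) :
  qform A (a *: v) = a ^+ 2 * qform A v.
Proof. by rewrite /qform [(a *: v)^T]linearZ/= -!scalemxAl -scalemxAr scalerA mxE expr2. Qed.

Lemma qform_scale (R : comPzRingType) (n : nat) (A : 'M[R]_n) (a : R) (v : 'cV[R]_n) :
  qform (a *: A) v = a * qform A v.
Proof. by rewrite /qform -scalemxAr -scalemxAl mxE. Qed.

Lemma qformDl (R : pzSemiRingType) (n : nat) (A B : 'M[R]_n) (v : 'cV[R]_n) :
  qform (A + B) v = qform A v + qform B v.
Proof. by rewrite /qform mulmxDr mulmxDl mxE. Qed.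

Lemma qform_shift (R : realType) (n : nat) (A : 'M[R]_n) (v w : 'cV[R]_n) :
  A^T = A -> qform A (v + w) = qform A v + (w^T *m (A *m v)) 0 0 *+ 2 + qform A w.
Proof.
move=> As; rewrite /qform [(v + w)^T]linearD/= !mulmxDl !mulmxDr.
rewrite [LHS]mxE [X in X + _ = _]mxE [X in _ + X = _]mxE.
have -> : (v^T *m A *m w) 0 0 = (w^T *m (A *m v)) 0 0.
  by rewrite -[v^T *m A *m w]mx11_trmx !trmx_mul trmxK As.
have -> : (w^T *m A *m v) 0 0 = (w^T *m (A *m v)) 0 0 by rewrite mulmxA.
lra.
Qed.

(** A zero of a nonnegative form is a minimum, so the gradient [P *m c] vanishes there: otherwise a
    small step against it would make the form negative. *)
Lemma psd_null (R : realType) (n : nat) (P : 'M[R]_n) (c : 'cV[R]_n) :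
  P^T = P -> (forall v, 0 <= qform P v) -> qform P c = 0 -> P *m c = 0.
Proof.
move=> Ps P0 c0; apply/eqP; rewrite -sqn_eq0; apply/eqP.
set w := P *m c; set W := sqn w; set B := qform P w.
have B0 : 0 <= B by exact: P0.
have W0 : 0 <= W by exact: sqn_ge0.
have := P0 (c + (- (W / (B + 1))) *: w).
rewrite qform_shift// c0 add0r qformZ -/w -/B.
have -> : (((- (W / (B + 1))) *: w)^T *m w) 0 0 = - (W / (B + 1)) * W.
  by rewrite [(_ *: w)^T]linearZ/= -scalemxAl mxE /W /sqn /qform mulmx1.
(* Step length; the added 1 keeps the denominator positive. Nonnegativity of the form reads
   [- 2 r W + r^2 B >= 0] with [W = r (B + 1)], that is [- r^2 (B + 2) >= 0]. *)
set r := W / (B + 1).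
have rB : r * (B + 1) = W by rewrite /r divfK// gt_eqF// ltr_wpDl.
have r0 : 0 <= r by rewrite divr_ge0// addr_ge0.
move=> H; have : r = 0 by nra.
by move=> r00; rewrite -rB r00 mul0r.
Qed.

Lemma qform_continuous_comp (R : realType) (T : topologicalType) (n : nat)
    (A : 'M[R]_n) (v : T -> 'cV[R]_n) :
  (forall i, continuous (fun t => v t i 0)) -> continuous (fun t => qform A (v t)).
Proof.
move=> cv t.
have -> : (fun t => qform A (v t)) =
    (fun t => \sum_j (\sum_i v t i 0 * A i j) * v t j 0).
  by apply/funext => s; rewrite qformE.
apply: cvg_big => [|j _]; first exact: add_continuous.
apply: cvgM; last exact: cv.
by apply: cvg_big => [|i _]; [exact: add_continuous|apply: cvgM; [exact: cv|exact: cvg_cst]].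
Qed.

Lemma qform_continuous (R : realType) (n : nat) (A : 'M[R]_n) :
  continuous (qform A : 'cV[R]_n -> R).
Proof. by apply: qform_continuous_comp => i; exact: coord_continuous. Qed.

Lemma qform_trmx_continuous (R : realType) (n : nat) (A : 'M[R]_n) :
  continuous (fun u : 'rV[R]_n => qform A u^T).
Proof.
apply: qform_continuous_comp => i; under eq_fun do rewrite mxE.
exact: coord_continuous.
Qed.

(** The form attains its minimum on the compact unit sphere, and homogeneity extends the inequality
    to all vectors. *)
Lemma rayleigh_min (R : realType) (d : nat) (A : 'M[R]_d) :
  (0 < d)%N -> A^T = A ->
  exists2 v : 'cV[R]_d, sqn v = 1 & forall w, qform A v * sqn w <= qform A w.
Proof.
move=> d0 As; pose S : set 'rV[R]_d := [set u | sqn u^T = 1].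
have S0 : S !=set0.
  exists (delta_mx 0 (Ordinal d0)); rewrite /S/= sqnE (bigD1 (Ordinal d0))//= big1.
    by rewrite !mxE !eqxx expr1n addr0.
  by move=> i iN; rewrite !mxE/= (negbTE iN) expr0n.
have cS : compact S.
  (* The sphere is a closed subset of the cube with sides [[-1, 1]]. *)
  have K := @rV_compact R^o d (fun=> `[-1, 1]%classic) (fun=> @segment_compact _ _ _).
  apply: subclosed_compact K _.
    have -> : S = (fun u : 'rV[R]_d => sqn u^T) @^-1` [set 1] by [].
    apply: closed_comp; last exact: closed_eq.
    by move=> u _; exact: qform_trmx_continuous.
  move=> u uS i /=; rewrite in_itv/= -ler_norml -(expr_le1 (n := 2))//.
  rewrite -normrX ger0_norm ?sqr_ge0// -uS sqnE (bigD1 i)//= mxE lerDl.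
  by rewrite sumr_ge0// => j _; exact: sqr_ge0.
have cA : {within S, continuous (fun u : 'rV[R]_d => qform A u^T)}.
  by apply: continuous_subspaceT; exact: qform_trmx_continuous.
have [c cS' cmin] := EVT_min_rV S0 cS cA.
exists c^T; first by move: cS'; rewrite inE.
move=> w; have [->|w0] := eqVneq w 0.
  by rewrite /sqn [qform A 0]/qform [qform _ 0]/qform !mulmx0 mxE mulr0.
have W0 : 0 < sqn w by rewrite sqn_gt0.
pose r := (Num.sqrt (sqn w))^-1.
have r2 : r ^+ 2 = (sqn w)^-1 by rewrite exprVn sqr_sqrtr// ltW.
have := cmin (r *: w)^T; rewrite inE /S/= trmxK /sqn !qformZ r2 mulVf ?gt_eqF//.
by move=> /(_ erefl); rewrite mulrC ler_pdivlMr.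
Qed.

Lemma eigenvalueN (R : realType) (d : nat) (A : 'M[R]_d) (a : R) :
  eigenvalue (- A) (- a) = eigenvalue A a.
Proof.
apply/eigenvalueP/eigenvalueP => -[v vA v0]; exists v => //.
  by apply: oppr_inj; rewrite -mulmxN vA scaleNr.
by rewrite mulmxN vA scaleNr.
Qed.

Lemma lambda_maxE (R : realType) (d : nat) (A : 'M[R]_d) :
  lambda_max A = - lambda_min (- A).
Proof.
rewrite /lambda_max /lambda_min /inf opprK; congr sup.
apply/seteqP; split => a /=.
  by move=> Aa; exists (- a); rewrite ?opprK//= eigenvalueN.
by move=> [b Ab <-]; rewrite -eigenvalueN opprK.
Qed.

(** The form of [A - l I], with [l] the minimal Rayleigh quotient, is nonnegative and vanishes at
    the minimiser, which [psd_null] turns into an eigenvector. Conversely every eigenvalue is a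
    Rayleigh quotient, hence at least [l]. With [0 < d] the spectrum is nonempty, so the infimum is
    not a default value. *)
Lemma lambda_min_attained (R : realType) (d : nat) (A : 'M[R]_d) :
  (0 < d)%N -> A^T = A ->
  (exists2 v : 'cV[R]_d, v != 0 & qform A v = lambda_min A * sqn v) /\
  (forall w, lambda_min A * sqn w <= qform A w).
Proof.
move=> d0 As; have [c c1 cmin] := rayleigh_min d0 As.
have c0 : c != 0 by rewrite -sqn_gt0 c1.
pose l := qform A c.
have P0 v : 0 <= qform (A - l *: 1%:M) v.
  by rewrite -scaleNr qformDl qform_scale mulNr subr_ge0; exact: cmin.
have Pc : (A - l *: 1%:M) *m c = 0.
  apply: psd_null => //; first by rewrite linearB/= linearZ/= As trmx1.
  by rewrite -scaleNr qformDl qform_scale mulNr -/(sqn c) c1 mulr1 subrr.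
have lE : eigenvalue A l.
  apply/eigenvalueP; exists c^T; last by rewrite trmx_eq0.
  apply: trmx_inj; rewrite trmx_mul As trmxK linearZ/= trmxK.
  by apply/eqP; rewrite -subr_eq0 -[l *: c]mul_scalar_mx -mulmxBl -scalemx1 Pc.
have lminE : lambda_min A = l.
  have lb : lbound [set a : R | eigenvalue A a] l.
    move=> a /= /eigenvalueP[v vA v0].
    have W0 : 0 < sqn v^T by rewrite sqn_gt0 trmx_eq0.
    have := cmin v^T; rewrite -/l [qform A v^T]/qform trmxK vA -scalemxAl mxE.
    have -> : (v *m v^T) 0 0 = sqn v^T by rewrite /sqn /qform trmxK mulmx1.
    by rewrite ler_pM2r.
  apply/eqP; rewrite eq_le; apply/andP; split.
    by apply: ge_inf => //; exists l.
  by apply: lb_le_inf => //; exists l.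
split; last by move=> w; rewrite lminE; exact: cmin.
by exists c => //; rewrite lminE c1 mulr1.
Qed.

Lemma lambda_min_le (R : realType) (d : nat) (A : 'M[R]_d) (w : 'cV[R]_d) :
  (0 < d)%N -> A^T = A -> lambda_min A * sqn w <= qform A w.
Proof. by move=> d0 /(lambda_min_attained d0)[]. Qed.

Lemma lambda_max_ge (R : realType) (d : nat) (A : 'M[R]_d) (w : 'cV[R]_d) :
  (0 < d)%N -> A^T = A -> qform A w <= lambda_max A * sqn w.
Proof.
move=> d0 As; rewrite lambda_maxE mulNr lerNr.
have -> : - qform A w = qform (- A) w by rewrite -(scaleN1r A) qform_scale mulN1r.
by apply: lambda_min_le => //; rewrite linearN/= As.
Qed.

(** * Lattice approximation and measurability of the extreme eigenvalues *)

Definition gridpt (R : realType) (n k : nat) (z : {ffun 'I_n -> int}) : 'cV[R]_n :=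
  \col_i ((z i)%:~R / k.+1%:R).

(** Index of the lower corner of the cell of mesh [1 / k.+1] containing [v]. Indices range over a
    countable type, so unions over them preserve measurability. *)
Definition gridix (R : realType) (n k : nat) (v : 'cV[R]_n) : {ffun 'I_n -> int} :=
  [ffun i => Num.floor (k.+1%:R * v i 0)].

Lemma grid_cvg (R : realType) (n : nat) (v : 'cV[R]_n) :
  (fun k => gridpt R k (gridix k v)) @ \oo --> v.
Proof.
apply/cvg_ballP => e e0; near=> k; split => // i j.
rewrite ord1 !mxE ffunE /ball/=.
have k0 : 0 < k.+1%:R :> R by [].
set x := v i 0; have /andP[xl xu] := floor_itv (k.+1%:R * x).
set z := Num.floor _ in xl xu *.
have -> : x - z%:~R / k.+1%:R = (k.+1%:R * x - z%:~R) / k.+1%:R.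
  by rewrite mulrBl mulrAC divff ?mul1r// gt_eqF.
rewrite normrM ger0_norm ?subr_ge0// gtr0_norm ?invr_gt0// ltr_pdivrMr//.
apply: (@lt_trans _ _ 1); first by rewrite ltrBlDl -(intrD _ z 1%Z).
rewrite -ltr_pdivrMr// mul1r.
near: k; exact: near_infty_natSinv_lt (PosNum e0).
Unshelve. all: by end_near. Qed.

(* By homogeneity and density, countably many test vectors suffice; this is what
   makes [lambda_min] measurable. *)
Lemma lambda_min_ltP (R : realType) (d : nat) (A : 'M[R]_d) (c : R) :
  (0 < d)%N -> A^T = A ->
  lambda_min A < c <->
  exists z : {ffun 'I_d -> int},
    qform A (gridpt R 0 z) < c * sqn (gridpt R 0 z).
Proof.
move=> d0 As; split.
  move=> lc; have [[v v0 vE] _] := lambda_min_attained d0 As.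
  pose P := A - c *: 1%:M.
  have PE w : qform P w = qform A w - c * sqn w.
    by rewrite /P -scaleNr qformDl qform_scale mulNr.
  have Pv : qform P v < 0.
    by rewrite PE vE -mulrBl pmulr_llt0 ?sqn_gt0// subr_lt0.
  have : (fun k => qform P (gridpt R k (gridix k v))) @ \oo --> qform P v.
    by apply: continuous_cvg; [exact: qform_continuous|exact: grid_cvg].
  move=> /cvgr_lt/(_ _ Pv)[k _ /(_ k (leqnn k))/= Hk].
  exists (gridix k v); rewrite -subr_lt0 -PE.
  have -> : gridpt R 0 (gridix k v) = k.+1%:R *: gridpt R k (gridix k v).
    by apply/matrixP => i j; rewrite !mxE divr1 mulrC divfK// pnatr_eq0.
  by rewrite qformZ pmulr_rlt0// exprn_gt0.
move=> [z]; set w := gridpt R 0 z => Hz.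
have le := lambda_min_le w d0 As.
have w0 : 0 < sqn w.
  rewrite lt_neqAle sqn_ge0 andbT; apply/eqP => w0.
  by move: le Hz; rewrite -w0 !mulr0 => /le_lt_trans H /H; rewrite ltxx.
by rewrite -(ltr_pM2r w0); exact: le_lt_trans Hz.
Qed.

Lemma measurable_setltr (R : realType) (d : measure_display) (T : measurableType d)
    (f g : T -> R) :
  measurable_fun setT f -> measurable_fun setT g -> measurable [set t | f t < g t].
Proof.
move=> mf mg; rewrite -[X in measurable X]setTI.
exact: (measurable_fun_ltr mf mg measurableT (Y := [set true])).
Qed.

Lemma measurable_setler (R : realType) (d : measure_display) (T : measurableType d)
    (f g : T -> R) :
  measurable_fun setT f -> measurable_fun setT g -> measurable [set t | f t <= g t].
Proof.
move=> mf mg; rewrite -[X in measurable X]setTI.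
exact: (measurable_fun_ler mf mg measurableT (Y := [set true])).
Qed.

Lemma measurable_lambda_min (R : realType) (dd : measure_display) (T : measurableType dd)
    (d : nat) (A : T -> 'M[R]_d) :
  (0 < d)%N -> (forall t, (A t)^T = A t) ->
  (forall i j, measurable_fun setT (fun t => A t i j)) ->
  measurable_fun setT (fun t => lambda_min (A t)).
Proof.
move=> d0 As mA.
apply: (measurability _ (RGenInftyO.measurableE R)).
move=> _ [_ [c ->] <-]; rewrite setTI.
rewrite (_ : _ @^-1` _ = \bigcup_(z : {ffun 'I_d -> int})
    [set t | qform (A t) (gridpt R 0 z) < c * sqn (gridpt R 0 z)]); last first.
  apply/seteqP; split => t /=.
    by rewrite in_itv/= => /(lambda_min_ltP _ d0 (As t))[z Hz]; exists z.
  by move=> [z _ Hz]; rewrite in_itv/=; apply/(lambda_min_ltP _ d0 (As t)); exists z.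
apply: countable_bigcupT_measurable => // z.
apply: measurable_setltr => //; exact: measurable_qform.
Qed.

Lemma measurable_lambda_max (R : realType) (dd : measure_display) (T : measurableType dd)
    (d : nat) (A : T -> 'M[R]_d) :
  (0 < d)%N -> (forall t, (A t)^T = A t) ->
  (forall i j, measurable_fun setT (fun t => A t i j)) ->
  measurable_fun setT (fun t => lambda_max (A t)).
Proof.
move=> d0 As mA; under eq_fun do rewrite lambda_maxE.
apply: measurableT_comp => //; apply: measurable_lambda_min => //.
  by move=> t; rewrite linearN/= As.
by move=> i j; under eq_fun do rewrite mxE; exact: measurableT_comp.
Qed.

(** Links the topology of column vectors to the product sigma-algebra of tuples: [f] is the
    pointwise limit of its values at cell corners, and each approximant is constant on countably
    many measurable boxes. *)
Lemma continuous_measurable_tcol (R : realType) (n : nat) (f : 'cV[R]_n -> R) :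
  continuous f -> measurable_fun setT (fun t : n.-tuple R => f (tcol t)).
Proof.
move=> cf.
apply: (@measurable_fun_cvg _ _ R setT
  (fun k t => f (gridpt R k (gridix k (tcol t))))); last first.
  by move=> t _; apply: continuous_cvg; [exact: cf|exact: grid_cvg].
move=> k _ Y mY; rewrite setTI.
(* The preimage of [Y] is the union of the cells whose corner value lies in [Y]. *)
rewrite (_ : _ @^-1` _ = \bigcup_(z : {ffun 'I_n -> int})
    (if `[< Y (f (gridpt R k z)) >] then
      \big[setI/setT]_(i < n) [set t : n.-tuple R |
        k.+1%:R * tnth t i \in `[(z i)%:~R, (z i + 1)%:~R[ ] else set0)); last first.
  apply/seteqP; split => t /=.
    move=> Yt; exists (gridix k (tcol t)) => //=; rewrite asboolT//.
    rewrite -bigcap_seq => i _ /=.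
    by rewrite ffunE mxE in_itv/= floor_itv.
  move=> [z _]; case: asboolP => //= Yz; rewrite -bigcap_seq => Hz.
  rewrite (_ : gridix _ _ = z)//.
  apply/ffunP => i; rewrite ffunE mxE; apply/eqP; rewrite floor_eq.
  by have := Hz i (mem_index_enum i); rewrite /= in_itv.
apply: countable_bigcupT_measurable => // z.
case: ifP => // _; apply: bigsetI_measurable => i _.
rewrite -[X in measurable X]setTI.
have mi : measurable_fun [set: n.-tuple R] (fun t => k.+1%:R * tnth t i).
  by apply: measurable_funM => //; exact: measurable_tnth.
exact: (mi measurableT [set` `[(z i)%:~R, (z i + 1)%:~R[ ] (measurable_itv _)).
Qed.

(** * Expectations over histories *)

(* No measurability is needed: the integral of a nonnegative function is a
   supremum over the simple functions below it. *)
Lemma ge0_le_integralT (R : realType) (d : measure_display) (T : measurableType d)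
    (mu : {measure set T -> \bar R}) (f g : T -> \bar R) :
  (forall x, 0 <= f x)%E -> (forall x, f x <= g x)%E ->
  (\int[mu]_x f x <= \int[mu]_x g x)%E.
Proof.
move=> f0 fg; have g0 x : (0 <= g x)%E by exact: le_trans (fg x).
rewrite !ge0_integralTE//; apply: le_ereal_sup => _ [h hf <-].
by exists h => // x; exact: le_trans (fg x).
Qed.

Section integral_normal_prob.
Import HBNNSimple.

(** Change of measure to the density, first for simple functions, then by monotone convergence on
    both sides. *)
Lemma integral_normal_prob (R : realType) (m s : R) (f : measurableTypeR R -> \bar R) :
  (forall y, 0 <= f y)%E -> measurable_fun setT f ->
  (\int[normal_prob m s]_y f y =
   \int[@lebesgue_measure R]_y (f y * (normal_pdf m s y)%:E))%E.
Proof.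
move=> f0 mf; pose g := nnsfun_approx measurableT mf.
have p0 y : (0 <= (normal_pdf m s y)%:E)%E by rewrite lee_fin normal_pdf_ge0.
have mp : measurable_fun setT (fun y : measurableTypeR R => (normal_pdf m s y)%:E).
  by apply/measurable_EFinP; exact: measurable_normal_pdf.
have gE k : (\int[normal_prob m s]_y (g k y)%:E =
    \int[@lebesgue_measure R]_y ((g k y)%:E * (normal_pdf m s y)%:E))%E.
  rewrite integralT_nnsfun sintegralE.
  under [RHS]eq_integral => y _.
    rewrite (fimfunE (g k)) -fsumEFin// ge0_mule_fsuml; last first.
      by move=> r; rewrite lee_fin; exact: nnfun_muleindic_ge0.
    over.
  rewrite ge0_integral_fsum//; last 2 first.
  - move=> r; apply: emeasurable_funM => //.
    by apply/measurable_EFinP/measurable_funM.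
  - by move=> r y _; rewrite mule_ge0// nnfun_muleindic_ge0.
  apply: eq_fsbigr => r; rewrite inE => -[y _ <-].
  under [RHS]eq_integral do rewrite EFinM -muleA.
  rewrite ge0_integralZl//; last 3 first.
  - by apply: emeasurable_funM => //; apply/measurable_EFinP.
  - by move=> x _; rewrite mule_ge0// lee_fin.
  - by rewrite lee_fin.
  congr (_ * _)%E; rewrite /= /normal_prob [LHS]integral_mkcond.
  apply: eq_integral => x _; rewrite patchE indicE.
  by case: ifPn => _; rewrite ?mul1e ?mul0e.
have L1 : (\int[normal_prob m s]_y (g k y)%:E @[k --> \oo] -->
    \int[normal_prob m s]_y f y)%E.
  rewrite (_ : (fun y => f y) = (fun y => limn (fun k => (g k y)%:E))); last first.
    by apply/funext => y; apply/esym/cvg_lim => //; exact: cvg_nnsfun_approx.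
  apply: cvg_monotone_convergence => //.
  - by move=> k; exact/measurable_EFinP.
  - by move=> k y _; rewrite lee_fin.
  - by move=> y _ a b ab; rewrite lee_fin; exact/lefP/nd_nnsfun_approx.
have L2 : (\int[@lebesgue_measure R]_y ((g k y)%:E * (normal_pdf m s y)%:E)
    @[k --> \oo] --> \int[@lebesgue_measure R]_y (f y * (normal_pdf m s y)%:E))%E.
  rewrite (_ : (fun y => f y * _)%E =
      (fun y => limn (fun k => ((g k y)%:E * (normal_pdf m s y)%:E)%E))); last first.
    apply/funext => y; apply/esym/cvg_lim => //.
    by apply: cvgeZr => //; exact: cvg_nnsfun_approx.
  apply: cvg_monotone_convergence => //.
  - by move=> k; apply: emeasurable_funM => //; exact/measurable_EFinP.
  - by move=> k y _; rewrite mule_ge0// lee_fin.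
  - move=> y _ a b ab; rewrite lee_wpmul2r// lee_fin.
    exact/lefP/nd_nnsfun_approx.
by move: L2; rewrite -(eq_cvg \oo _ gE); exact: (cvg_unique _ L1).
Qed.

End integral_normal_prob.

Lemma integral_normal_cst (R : realType) (m s : R) (c : \bar R) :
  (\int[normal_prob m s]_y c = c)%E.
Proof.
rewrite integral_cst//.
by rewrite [X in (_ * X)%E](@probability_setT _ _ _ (normal_prob m s)) mule1.
Qed.

Lemma measurable_rcons (d d' : measure_display) (T : measurableType d)
    (U : measurableType d') (n : nat) (h : T -> n.-tuple U) (z : T -> U) :
  measurable_fun setT h -> measurable_fun setT z ->
  measurable_fun setT (fun t => [tuple of rcons (h t) (z t)]).
Proof.
move=> mh mz; apply/measurable_fun_tnthP => i.
have [ilt|ige] := ltnP i n.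
  rewrite (_ : _ \o _ = fun t => tnth (h t) (Ordinal ilt)).
    exact: (measurableT_comp (measurable_tnth (Ordinal ilt)) mh).
  apply/funext => t /=; rewrite (tnth_nth (z t)) (tnth_nth (z t))/= nth_rcons.
  by rewrite size_tuple ilt.
rewrite (_ : _ \o _ = z)//; apply/funext => t /=.
rewrite (tnth_nth (z t))/= nth_rcons size_tuple ltnNge ige/=.
by case: ifP.
Qed.

Section hexp_theory.
Context (R : realType) (p : nat) (Lam : sampling_rule R p) (b0 : 'cV[R]_p) (s : R).
Implicit Types F G : seq (p.-tuple R * R) -> \bar R.

Lemma hexp_ge0 F k j (h : hist R p j) :
  (forall l, 0 <= F l)%E -> (0 <= hexp Lam b0 s k h F)%E.
Proof.
move=> F0; elim: k j h => [|k IH] j h //=.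
by apply: integral_ge0 => x _; apply: integral_ge0 => y _; exact: IH.
Qed.

(** Holds without measurability, so it applies to events not known to be measurable. The comparison
    is only asked on lists of the final length. *)
Lemma hexp_le F G k j (h : hist R p j) :
  (forall l, 0 <= F l)%E -> (forall l, size l = (j + k)%N -> F l <= G l)%E ->
  (hexp Lam b0 s k h F <= hexp Lam b0 s k h G)%E.
Proof.
move=> F0; elim: k j h => [|k IH] j h FG /=.
  by apply: FG; rewrite size_tuple addn0.
apply: ge0_le_integralT => x.
  by apply: integral_ge0 => y _; exact: hexp_ge0.
apply: ge0_le_integralT => y; first exact: hexp_ge0.
by apply: IH => l sl; apply: FG; rewrite sl addSnnS.
Qed.

Lemma measurable_dotv (d : measure_display) (T : measurableType d)
    (x : T -> p.-tuple R) (b : T -> 'cV[R]_p) :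
  measurable_fun setT x -> (forall i, measurable_fun setT (fun t => b t i 0)) ->
  measurable_fun setT (fun t => dotv (x t) (b t)).
Proof.
move=> mx mb; rewrite /dotv; under eq_fun do rewrite mxE.
apply: measurable_sum => i; apply: measurable_funM => //.
under eq_fun do rewrite !mxE.
exact: (measurableT_comp (measurable_tnth i) mx).
Qed.

Lemma measurable_rcons_snd j (h : hist R p j) (x : p.-tuple R) :
  measurable_fun [set: measurableTypeR R]
    (fun y => [tuple of rcons h (x, y : R)] : hist R p j.+1).
Proof.
exact: measurable_rcons.
Qed.

(** The law of [y] varies with [x]. Writing it through its density gives a fixed Lebesgue integral
    of a jointly measurable function, to which Tonelli applies. *)
Lemma measurable_step j (G : hist R p j.+1 -> \bar R) :
  (forall h, 0 <= G h)%E -> measurable_fun setT G ->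
  measurable_fun setT (fun hx : hist R p j * p.-tuple R =>
   (\int[normal_prob (dotv hx.2 b0) s]_y G [tuple of rcons hx.1 (hx.2, y)])%E).
Proof.
move=> G0 mG.
pose K (w : (hist R p j * p.-tuple R) * measurableTypeR R) : \bar R :=
  (G [tuple of rcons w.1.1 (w.1.2, w.2 : R)] *
   (normal_pdf (dotv w.1.2 b0) s w.2)%:E)%E.
have m12 : measurable_fun setT
    (fun w : (hist R p j * p.-tuple R) * measurableTypeR R => w.1.2).
  exact: (measurableT_comp measurable_snd measurable_fst).
have m2 : measurable_fun setT
    (fun w : (hist R p j * p.-tuple R) * measurableTypeR R => w.2 : R).
  exact: measurable_snd.
have mgK : measurable_fun setT
    (fun w : (hist R p j * p.-tuple R) * measurableTypeR R =>
      G [tuple of rcons w.1.1 (w.1.2, w.2 : R)]).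
  apply: (measurableT_comp mG); apply: measurable_rcons.
    exact: (measurableT_comp measurable_fst measurable_fst).
  by apply/measurable_fun_pairP.
have mK : measurable_fun setT K.
  apply: emeasurable_funM => //; apply/measurable_EFinP => /=.
  (* For [s = 0] the density is by convention an indicator function, treated separately. *)
  rewrite /normal_pdf; case: (s == 0).
    exact: (measurableT_comp (measurable_indic _) m2).
  apply: measurable_funM => //; rewrite /normal_fun; apply: measurableT_comp => //.
  apply: measurable_funM => //; apply: measurableT_comp => //.
  apply: measurable_funX; apply: measurable_funB => //.
  exact: measurable_dotv.
have K0 w : (0 <= K w)%E by rewrite mule_ge0 ?G0// lee_fin normal_pdf_ge0.
rewrite (_ : (fun _ => _) = fubini_F (@lebesgue_measure R) K).
  exact: measurable_fun_fubini_tonelli_F.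
apply/funext => hx; rewrite /fubini_F integral_normal_prob//.
exact: (measurableT_comp mG (measurable_rcons_snd _ _)).
Qed.

Lemma measurable_step_snd j (h : hist R p j) (G : hist R p j.+1 -> \bar R) :
  (forall h, 0 <= G h)%E -> measurable_fun setT G ->
  measurable_fun setT (fun x : p.-tuple R =>
   (\int[normal_prob (dotv x b0) s]_y G [tuple of rcons h (x, y)])%E).
Proof.
move=> G0 mG.
exact: (measurableT_comp (measurable_step G0 mG) (pair1_measurable h)).
Qed.

(** The final length [n] is a variable tied to [j + k] by an equation, which spares the induction
    any cast between [j.+1 + k] and [j + k.+1]. *)
Lemma measurable_hexp F k j n : (forall l, 0 <= F l)%E -> (j + k)%N = n ->
  measurable_fun setT (fun h : hist R p n => F (tval h)) ->
  measurable_fun setT (fun h : hist R p j => hexp Lam b0 s k h F).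
Proof.
move=> F0; elim: k j => [|k IH] j jkn mF /=.
  by move: jkn; rewrite addn0 => jn; case: _ / jn mF.
have mG : measurable_fun setT (fun h : hist R p j.+1 => hexp Lam b0 s k h F).
  by apply: IH => //; rewrite -jkn addSnnS.
apply: (measurable_fun_integral_finite_kernel (fun hx : hist R p j * p.-tuple R =>
   (\int[normal_prob (dotv hx.2 b0) s]_y
     hexp Lam b0 s k [tuple of rcons hx.1 (hx.2, y)] F)%E)) => /=.
  by move=> z; apply: integral_ge0 => y _; exact: hexp_ge0.
apply: (measurable_step (G := fun h => hexp Lam b0 s k h F)) => // h.
exact: hexp_ge0.
Qed.

Lemma hexpD F G k j n (h : hist R p j) :
  (forall l, 0 <= F l)%E -> (forall l, 0 <= G l)%E -> (j + k)%N = n ->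
  measurable_fun setT (fun h : hist R p n => F (tval h)) ->
  measurable_fun setT (fun h : hist R p n => G (tval h)) ->
  hexp Lam b0 s k h (fun l => F l + G l)%E =
  (hexp Lam b0 s k h F + hexp Lam b0 s k h G)%E.
Proof.
move=> F0 G0; elim: k j h => [|k IH] j h jkn mF mG //=.
have jkn' : (j.+1 + k)%N = n by rewrite -jkn addSnnS.
have mhF := measurable_hexp F0 jkn' mF.
have mhG := measurable_hexp G0 jkn' mG.
have hF0 l : (0 <= hexp Lam b0 s k (l : hist R p j.+1) F)%E by exact: hexp_ge0.
have hG0 l : (0 <= hexp Lam b0 s k (l : hist R p j.+1) G)%E by exact: hexp_ge0.
under eq_integral => x _.
  under eq_integral do rewrite IH//.
  rewrite ge0_integralD//; last 2 first.
  - exact: (measurableT_comp mhF (measurable_rcons_snd _ _)).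
  - exact: (measurableT_comp mhG (measurable_rcons_snd _ _)).
  over.
rewrite ge0_integralD//.
- by move=> x _; exact: integral_ge0.
- exact: (measurable_step_snd h (G := fun h => hexp Lam b0 s k h F)).
- by move=> x _; exact: integral_ge0.
- exact: (measurable_step_snd h (G := fun h => hexp Lam b0 s k h G)).
Qed.

Lemma hexpZ F (c : R) k j n (h : hist R p j) :
  (forall l, 0 <= F l)%E -> 0 <= c -> (j + k)%N = n ->
  measurable_fun setT (fun h : hist R p n => F (tval h)) ->
  hexp Lam b0 s k h (fun l => c%:E * F l)%E = (c%:E * hexp Lam b0 s k h F)%E.
Proof.
move=> F0 c0; elim: k j h => [|k IH] j h jkn mF //=.
have jkn' : (j.+1 + k)%N = n by rewrite -jkn addSnnS.
have mhF := measurable_hexp F0 jkn' mF.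
have hF0 l : (0 <= hexp Lam b0 s k (l : hist R p j.+1) F)%E by exact: hexp_ge0.
under eq_integral => x _.
  under eq_integral do rewrite IH//.
  rewrite ge0_integralZl//; last exact: (measurableT_comp mhF (measurable_rcons_snd _ _)).
  over.
rewrite ge0_integralZl//.
- exact: (measurable_step_snd h (G := fun h => hexp Lam b0 s k h F)).
- by move=> x _; exact: integral_ge0.
Qed.

Lemma hexp_cst1 k j (h : hist R p j) : hexp Lam b0 s k h (fun=> 1%E) = 1%E.
Proof.
elim: k j h => [|k IH] j h //=.
under eq_integral => x _.
  under eq_integral do rewrite IH.
  rewrite integral_normal_cst.
  over.
by rewrite integral_cst// mul1e prob_kernel.
Qed.

Lemma hexp_sum (I : Type) (r : seq I)
    (F : I -> seq (p.-tuple R * R) -> \bar R) k j n (h : hist R p j) :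
  (forall i l, 0 <= F i l)%E -> (j + k)%N = n ->
  (forall i, measurable_fun setT (fun h : hist R p n => F i (tval h))) ->
  hexp Lam b0 s k h (fun l => \sum_(i <- r) F i l)%E =
  (\sum_(i <- r) hexp Lam b0 s k h (F i))%E.
Proof.
move=> F0 jkn mF; elim: r => [|i r IH].
  rewrite big_nil; under [X in hexp _ _ _ _ _ X]funext do rewrite big_nil.
  elim: k j h {jkn} => [|k IHk] j h //=.
  by apply: integral0_eq => x _; apply: integral0_eq => y _; exact: IHk.
rewrite big_cons; under [X in hexp _ _ _ _ _ X]funext do rewrite big_cons.
rewrite (hexpD _ _ _ jkn)//.
- by rewrite IH.
- by move=> l; exact: sume_ge0.
- by apply: emeasurable_sum.
Qed.

(** * Method of mixtures: Gaussian averages of likelihood ratios *)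

Section mixture.
Context (q : nat) (B : 'M[R]_(p, q)).

(** Likelihood ratio of [b0 + B u] against [b0] for one observation; the normalising constants
    cancel. [B] embeds a [q]-dimensional perturbation into the parameter space. *)
Definition lrat (u : q.-tuple R) (z : p.-tuple R * R) : R :=
  expR (((z.2 - dotv z.1 b0) ^+ 2 -
         (z.2 - dotv z.1 (b0 + B *m tcol u)) ^+ 2) / (2 * s ^+ 2)).

(* A martingale under [hexp]: the Gaussian average of the likelihood ratios of
   [b0 + B u] against [b0]. *)
Definition mixture (l : seq (p.-tuple R * R)) : \bar R :=
  lebint (fun u : q.-tuple R =>
    (expR (- sqn (tcol u) / (2 * s ^+ 2)) * \prod_(z <- l) lrat u z)%:E).

Lemma measurable_lrat (d : measure_display) (T : measurableType d)
    (u : T -> q.-tuple R) (z : T -> p.-tuple R * R) :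
  measurable_fun setT u -> measurable_fun setT z ->
  measurable_fun setT (fun t => lrat (u t) (z t)).
Proof.
move=> mu mz; rewrite /lrat; apply: measurableT_comp => //.
have mz1 : measurable_fun setT (fun t => (z t).1) by exact: (measurableT_comp measurable_fst mz).
have mz2 : measurable_fun setT (fun t => (z t).2) by exact: (measurableT_comp measurable_snd mz).
apply: measurable_funM => //; apply: measurable_funB; apply: measurable_funX.
  by apply: measurable_funB => //; exact: measurable_dotv.
apply: measurable_funB => //; apply: measurable_dotv => // i.
under eq_fun do rewrite !mxE; apply: measurable_funD => //.
apply: measurable_sum => k; apply: measurable_funM => //.
by under eq_fun do rewrite mxE; exact: (measurableT_comp (measurable_tnth k) mu).
Qed.

Lemma measurable_mixture_weight : measurable_fun setT
  (fun u : q.-tuple R => expR (- sqn (tcol u) / (2 * s ^+ 2))).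
Proof.
apply: measurableT_comp => //; apply: measurable_funM => //.
apply: measurableT_comp => //; apply: measurable_qform => // i.
by under eq_fun do rewrite mxE; exact: measurable_tnth.
Qed.

Let mixture_fun_ge0 u l :
  (0 <= (expR (- sqn (tcol u) / (2 * s ^+ 2)) * \prod_(z <- l) lrat u z)%:E)%E.
Proof. by rewrite lee_fin mulr_ge0 ?expR_ge0// prodr_ge0// => z _; rewrite expR_ge0. Qed.

Let measurable_mixture_fun l : measurable_fun setT (fun u : q.-tuple R =>
  (expR (- sqn (tcol u) / (2 * s ^+ 2)) * \prod_(z <- l) lrat u z)%:E).
Proof.
apply/measurable_EFinP; apply: measurable_funM; first exact: measurable_mixture_weight.
by apply: measurable_prod => z _; exact: measurable_lrat.
Qed.

Lemma mixture_ge0 l : (0 <= mixture l)%E.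
Proof.
have [mu muE] := lebint_measure R q.
by rewrite /mixture muE//; apply: integral_ge0.
Qed.

Lemma measurable_mixture n :
  measurable_fun setT (fun h : hist R p n => mixture (tval h)).
Proof.
have [mu muE] := lebint_measure R q.
pose K (w : hist R p n * q.-tuple R) : \bar R :=
  (expR (- sqn (tcol w.2) / (2 * s ^+ 2)) * \prod_(z <- tval w.1) lrat w.2 z)%:E.
rewrite (_ : (fun _ => _) = fubini_F mu K).
  apply: measurable_fun_fubini_tonelli_F => [|w]; last exact: mixture_fun_ge0.
  apply/measurable_EFinP; apply: measurable_funM.
    exact: (measurableT_comp measurable_mixture_weight measurable_snd).
  under eq_fun do rewrite big_tuple.
  apply: measurable_prod => i _; apply: measurable_lrat => //.
  exact: (measurableT_comp (measurable_tnth i) measurable_fst).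
by apply/funext => h; rewrite /mixture muE.
Qed.

Hypothesis s0 : s != 0.

(** The ratio times the density under [b0] is the density under [b0 + B u], of mass 1. *)
Lemma integral_lrat (u : q.-tuple R) (x : p.-tuple R) :
  (\int[normal_prob (dotv x b0) s]_y (lrat u (x, y))%:E = 1)%E.
Proof.
rewrite integral_normal_prob; last 2 first.
- by move=> y; rewrite lee_fin expR_ge0.
- by apply/measurable_EFinP; apply: measurable_lrat.
rewrite -[RHS](integral_normal_pdf (dotv x (b0 + B *m tcol u)) s).
apply: eq_integral => y _; rewrite -EFinM; congr (_%:E).
rewrite !normal_pdfE// /lrat /normal_fun mulrCA -expRD; congr (_ * expR _).
by rewrite -[s ^+ 2 *+ 2]mulr_natl/=; lra.
Qed.

(** Martingale property: Tonelli moves the [y] integral inside, where only the last factor depends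
    on [y] and integrates to 1. *)
Lemma mixture_step l (x : p.-tuple R) :
  (\int[normal_prob (dotv x b0) s]_y mixture (rcons l (x, y)) = mixture l)%E.
Proof.
have [mu muE] := lebint_measure R q.
rewrite /mixture; under eq_integral do rewrite muE//.
rewrite muE//.
pose K (w : measurableTypeR R * q.-tuple R) : \bar R :=
  (expR (- sqn (tcol w.2) / (2 * s ^+ 2)) * \prod_(z <- rcons l (x, w.1 : R)) lrat w.2 z)%:E.
have mxy : measurable_fun setT
    (fun w : measurableTypeR R * q.-tuple R => lrat w.2 (x, w.1 : R)).
  apply: measurable_lrat; first exact: measurable_snd.
  have m1 : measurable_fun setT (fun w : measurableTypeR R * q.-tuple R => w.1 : R).
    exact: measurable_fst.
  exact: (measurable_fun_pair (measurable_cst x) m1).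
rewrite (fubini_tonelli K); last 2 first.
- apply/measurable_EFinP; apply: measurable_funM.
    exact: (measurableT_comp measurable_mixture_weight measurable_snd).
  under eq_fun do rewrite -cats1 big_cat big_seq1 /=.
  apply: measurable_funM => //; apply: measurable_prod => z _.
  by apply: measurable_lrat => //; exact: measurable_snd.
- by move=> w; exact: mixture_fun_ge0.
apply: eq_integral => u _; rewrite /K/=.
under eq_integral do rewrite -cats1 big_cat big_seq1 /= mulrA EFinM.
rewrite ge0_integralZl//.
- by rewrite integral_lrat mule1.
- by apply/measurable_EFinP; apply: measurable_lrat.
- by move=> y _; rewrite lee_fin expR_ge0.
Qed.

(** One step preserves the mixture for every covariate [x], so averaging over [x] does too, however
    adaptively [Lam] chooses it. *)
Lemma hexp_mixture k j (h : hist R p j) :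
  hexp Lam b0 s k h mixture = mixture (tval h).
Proof.
elim: k j h => [|k IH] j h //=.
under eq_integral => x _.
  under eq_integral do rewrite IH.
  rewrite /= mixture_step.
  over.
by rewrite integral_cst// prob_kernel mule1.
Qed.

End mixture.

End hexp_theory.

(** * Least squares and blocks *)

Lemma index_allpairs_pair (S T : eqType) (s : seq S) (t : seq T) x y :
  x \in s -> y \in t ->
  index (x, y) [seq (a, b) | a <- s, b <- t] = (index x s * size t + index y t)%N.
Proof.
move=> + yt; elim: s => [//|a s IH]; rewrite inE allpairs_cons index_cat /=.
have [<- _|ax /= xs] := eqVneq x a.
  by rewrite ?eqxx/= mul0n map_f// index_map// => b c [].
rewrite ?[a == x]eq_sym ?(negbTE ax) mulSn -addnA -(IH xs) size_map.
by case: mapP => // -[b _ [xa]]; rewrite xa eqxx in ax.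
Qed.

(** Reconciles the two descriptions of a block: [Tproj] uses [mxvec_index], while [in_blocks] tests
    [k %/ d]. *)
Lemma mxvec_index_val (m d : nat) (i : 'I_m) (l : 'I_d) :
  mxvec_index i l = (i * d + l)%N :> nat.
Proof.
rewrite /mxvec_index/=.
have -> : enum_rank (i, l) = index (i, l) (enum {: 'I_m * 'I_d}) :> nat.
  rewrite -[X in index X _](nth_enum_rank (i, l) (i, l)) index_uniq ?enum_uniq//.
  by rewrite -cardE ltn_ord.
have -> : enum {: 'I_m * 'I_d} = [seq (a, b) | a <- enum 'I_m, b <- enum 'I_d].
  by rewrite enumT unlock.
by rewrite index_allpairs_pair ?mem_enum// !index_enum_ord size_enum_ord.
Qed.

Lemma mxvec_index_div (m d : nat) (i : 'I_m) (l : 'I_d) :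
  (mxvec_index i l %/ d)%N = i.
Proof.
rewrite mxvec_index_val divnMDl ?(leq_ltn_trans _ (ltn_ord l))//.
by rewrite divn_small// addn0.
Qed.

Lemma sum_blocks (V : nmodType) (m d : nat) (F : 'I_(m * d) -> V) :
  \sum_k F k = \sum_(i < m) \sum_(l < d) F (mxvec_index i l).
Proof.
rewrite pair_big/= (reindex _ (curry_mxvec_bij m d))/=.
by apply: eq_bigr => -[i l] _.
Qed.

Section regression.
Context (R : realType) (p : nat).
Implicit Type h : seq (p.-tuple R * R).

Definition gram h : 'M[R]_p := (Xmat h)^T *m Xmat h.

Lemma dotvE (x : p.-tuple R) (b : 'cV[R]_p) : dotv x b = \sum_k tnth x k * b k 0.
Proof. by rewrite /dotv mxE; apply: eq_bigr => k _; rewrite !mxE. Qed.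

Lemma dotvD (x : p.-tuple R) (b c : 'cV[R]_p) : dotv x (b + c) = dotv x b + dotv x c.
Proof. by rewrite /dotv mulmxDr mxE. Qed.

Lemma Xmat_mul h (b : 'cV[R]_p) j :
  (Xmat h *m b) j 0 = dotv (tnth (in_tuple h) j).1 b.
Proof. by rewrite dotvE mxE; apply: eq_bigr => k _; rewrite mxE. Qed.

Lemma Xmat_trmul h (w : 'cV[R]_(size h)) k :
  ((Xmat h)^T *m w) k 0 = \sum_j tnth (tnth (in_tuple h) j).1 k * w j 0.
Proof. by rewrite mxE; apply: eq_bigr => j _; rewrite !mxE. Qed.

Lemma qform_gram h (w : 'cV[R]_p) : qform (gram h) w = \sum_(z <- h) dotv z.1 w ^+ 2.
Proof.
rewrite /qform /gram -[w^T *m _ *m w]mulmxA -!mulmxA mulmxA -trmx_mul mxE.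
rewrite [RHS](big_tnth _ _ h); apply: eq_bigr => j _.
by rewrite mxE Xmat_mul expr2.
Qed.

Lemma gram_sym h : (gram h)^T = gram h.
Proof. by rewrite /gram trmx_mul trmxK. Qed.

Lemma gram_mul h (w : 'cV[R]_p) k :
  (gram h *m w) k 0 = \sum_(z <- h) tnth z.1 k * dotv z.1 w.
Proof.
rewrite /gram -mulmxA Xmat_trmul (big_tnth _ _ h); apply: eq_bigr => j _.
by rewrite Xmat_mul.
Qed.

(** The normal equations, recentred at an arbitrary [b]. *)
Lemma gram_ols h (b : 'cV[R]_p) k : gram h \in unitmx ->
  (gram h *m (ols h - b)) k 0 = \sum_(z <- h) tnth z.1 k * (z.2 - dotv z.1 b).
Proof.
move=> Vu; rewrite mulmxBr /ols -/(gram h) mulKVmx// mxE Xmat_trmul.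
rewrite [X in _ + X]mxE gram_mul.
rewrite [X in _ - X](big_tnth _ _ h) -sumrB [RHS](big_tnth _ _ h).
by apply: eq_bigr => j _; rewrite mxE mulrBr.
Qed.

(** Pythagoras: [gram_ols] at [b = ols h] makes the residuals orthogonal to every column of the
    design, which kills the cross term. *)
Lemma rss_ols h (b : 'cV[R]_p) : gram h \in unitmx ->
  \sum_(z <- h) (z.2 - dotv z.1 b) ^+ 2 =
  \sum_(z <- h) (z.2 - dotv z.1 (ols h)) ^+ 2 + qform (gram h) (b - ols h).
Proof.
move=> Vu; set e := b - ols h.
have E z : (z.2 - dotv z.1 b) ^+ 2 = (z.2 - dotv z.1 (ols h)) ^+ 2 +
    dotv z.1 e ^+ 2 - dotv z.1 e * (z.2 - dotv z.1 (ols h)) *+ 2.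
  have -> : b = ols h + e by rewrite /e addrCA subrr addr0.
  rewrite dotvD; lra.
under eq_bigr do rewrite E.
rewrite sumrB big_split/= -qform_gram sumrMnl; apply/eqP.
rewrite -subr_eq0 addrAC subrr sub0r oppr_eq0; apply/eqP.
suff -> : \sum_(z <- h) dotv z.1 e * (z.2 - dotv z.1 (ols h)) = 0 by rewrite mul0rn.
under eq_bigr do rewrite dotvE mulr_suml.
rewrite exchange_big/= big1// => k _.
under eq_bigr do rewrite mulrAC.
rewrite -mulr_suml -gram_ols// subrr mulmx0 mxE mul0r//.
Qed.

(** As a function of [b] the likelihood is thus an unnormalised Gaussian density centred at
    [ols h]. *)
Lemma lik_ols (s : R) h (b : 'cV[R]_p) : gram h \in unitmx ->
  lik s h b = lik s h (ols h) * expR (- qform (gram h) (b - ols h) / (2 * s ^+ 2)).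
Proof.
move=> Vu; rewrite /lik -!expR_sum -expRD; congr expR.
rewrite -!mulr_suml -mulrDl; congr (_ / _).
by rewrite !sumrN (rss_ols b Vu) opprD.
Qed.

End regression.

(** * Block structure of the design *)

Section blocks.
Context (R : realType) (m d : nat).
Implicit Types (h : seq ((m * d).-tuple R * R)) (x : (m * d).-tuple R).

Definition blk (i : 'I_m) (w : 'cV[R]_(m * d)) : 'cV[R]_d :=
  \col_l w (mxvec_index i l) 0.

Definition blkmx (i : 'I_m) : 'M[R]_(m * d, d) :=
  \matrix_(k, l) (k == mxvec_index i l)%:R.

Definition tdot (i : 'I_m) x (u : 'cV[R]_d) : R := ((Tproj i x)^T *m u) 0 0.

Lemma tdotE i x u : tdot i x u = \sum_l tnth x (mxvec_index i l) * u l 0.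
Proof. by rewrite /tdot mxE; apply: eq_bigr => l _; rewrite !mxE. Qed.

Lemma sqn_blocks (w : 'cV[R]_(m * d)) : sqn w = \sum_i sqn (blk i w).
Proof.
rewrite sqnE sum_blocks; apply: eq_bigr => i _; rewrite sqnE.
by apply: eq_bigr => l _; rewrite mxE.
Qed.

Lemma dotv_blocks x (w : 'cV[R]_(m * d)) : dotv x w = \sum_i tdot i x (blk i w).
Proof.
rewrite dotvE sum_blocks; apply: eq_bigr => i _; rewrite tdotE.
by apply: eq_bigr => l _; rewrite mxE.
Qed.

Lemma dotv_blkmx i x (u : 'cV[R]_d) : dotv x (blkmx i *m u) = tdot i x u.
Proof.
rewrite /dotv mulmxA /tdot; congr ((_ *m _) 0 0); apply/matrixP => a l.
rewrite !mxE (bigD1 (mxvec_index i l))//= !mxE eqxx mulr1 big1 ?addr0//.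
by move=> k kl; rewrite !mxE (negbTE kl) mulr0.
Qed.

Lemma Tproj_out_block x : in_blocks x ->
  exists i0, forall i, i != i0 -> Tproj i x = 0.
Proof.
move=> [i0 Hi0]; exists i0 => i ii0; apply/matrixP => l a; rewrite !mxE.
apply: Hi0; rewrite mxvec_index_div; exact: ii0.
Qed.

(** Only one block of [x] can be nonzero, so all cross terms vanish; summed over the history, this
    makes [gram] block diagonal. *)
Lemma dotv_sqr_blocks x (w : 'cV[R]_(m * d)) : in_blocks x ->
  dotv x w ^+ 2 = \sum_i tdot i x (blk i w) ^+ 2.
Proof.
move=> /Tproj_out_block[i0 H].
have T0 i u : i != i0 -> tdot i x u = 0.
  by move=> /H T0; rewrite /tdot T0 trmx0 mul0mx mxE.
rewrite dotv_blocks (bigD1 i0)//= big1; last by move=> i /T0.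
rewrite addr0 (bigD1 i0)//= [X in _ + X]big1 ?addr0//.
by move=> i /T0 ->; rewrite expr0n.
Qed.

Lemma coord_dotv_block x (w : 'cV[R]_(m * d)) i l : in_blocks x ->
  tnth x (mxvec_index i l) * dotv x w = tnth x (mxvec_index i l) * tdot i x (blk i w).
Proof.
move=> /Tproj_out_block[i0 H]; have [->|ii0] := eqVneq i i0.
  rewrite dotv_blocks (bigD1 i0)//= big1 ?addr0// => k ki.
  by rewrite /tdot H// trmx0 mul0mx mxE.
have /matrixP/(_ l 0) := H _ ii0; rewrite !mxE => ->.
by rewrite !mul0r.
Qed.

Lemma Iblock_sym i h : (Iblock i h)^T = Iblock i h.
Proof.
rewrite /Iblock linear_sum/=; apply: eq_bigr => z _.
by rewrite trmx_mul trmxK.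
Qed.

Lemma Iblock_mul i h (u : 'cV[R]_d) l :
  (Iblock i h *m u) l 0 = \sum_(z <- h) tnth z.1 (mxvec_index i l) * tdot i z.1 u.
Proof.
rewrite /Iblock mulmx_suml summxE; apply: eq_bigr => z _.
by rewrite -mulmxA mxE big_ord1 mxE.
Qed.

Lemma qform_Iblock i h (u : 'cV[R]_d) :
  qform (Iblock i h) u = \sum_(z <- h) tdot i z.1 u ^+ 2.
Proof.
rewrite /qform /Iblock mulmx_sumr mulmx_suml summxE; apply: eq_bigr => z _.
rewrite mulmxA -mulmxA mxE big_ord1 expr2 /tdot; congr (_ * _).
by rewrite -[u^T *m _]mx11_trmx trmx_mul trmxK.
Qed.

Lemma qform_gram_blocks h (w : 'cV[R]_(m * d)) :
  (forall z, z \in h -> in_blocks z.1) ->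
  qform (gram h) w = \sum_i qform (Iblock i h) (blk i w).
Proof.
move=> hb; rewrite qform_gram.
rewrite (eq_big_seq (fun z => \sum_i tdot i z.1 (blk i w) ^+ 2)).
  by rewrite exchange_big/=; apply: eq_bigr => i _; rewrite qform_Iblock.
by move=> z /hb; exact: dotv_sqr_blocks.
Qed.

(** The normal equations decouple: block [i] of the error solves a system involving [Iblock i h]
    alone. *)
Lemma Iblock_ols i h (b : 'cV[R]_(m * d)) :
  (forall z, z \in h -> in_blocks z.1) -> gram h \in unitmx ->
  Iblock i h *m blk i (ols h - b) =
  \col_l \sum_(z <- h) tnth z.1 (mxvec_index i l) * (z.2 - dotv z.1 b).
Proof.
move=> hb Vu; apply/matrixP => l a; rewrite ord1 [RHS]mxE -gram_ols// Iblock_mul gram_mul.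
by apply: eq_big_seq => z /hb zb; rewrite coord_dotv_block.
Qed.

(** A lower bound common to all diagonal blocks is one for the block diagonal matrix. *)
Lemma gram_posdef h (c : R) : (forall z, z \in h -> in_blocks z.1) -> (0 < d)%N ->
  0 < c -> (forall i, c <= lambda_min (Iblock i h)) ->
  posdef (gram h) /\ forall w, c * sqn w <= qform (gram h) w.
Proof.
move=> hb d0 c0 cl.
have H w : c * sqn w <= qform (gram h) w.
  rewrite qform_gram_blocks// sqn_blocks mulr_sumr; apply: ler_sum => i _.
  apply: le_trans (lambda_min_le _ d0 (Iblock_sym i h)).
  by rewrite ler_wpM2r ?sqn_ge0.
split=> //; split; first exact: gram_sym.
by move=> v v0; apply: lt_le_trans (H v); rewrite mulr_gt0 ?sqn_gt0.
Qed.

End blocks.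

(** * Total variation bound *)

Lemma lebint_ge0 (R : realType) (n : nat) (F : n.-tuple R -> \bar R) :
  (forall t, 0 <= F t)%E -> (0 <= lebint F)%E.
Proof.
elim: n F => [|n IH] F F0 //=.
by apply: integral_ge0 => x _; exact: IH.
Qed.

Lemma lebint_le (R : realType) (n : nat) (F G : n.-tuple R -> \bar R) :
  (forall t, 0 <= F t)%E -> (forall t, F t <= G t)%E -> (lebint F <= lebint G)%E.
Proof.
elim: n F G => [|n IH] F G F0 FG //=.
apply: ge0_le_integralT => x; first exact: lebint_ge0.
exact: IH.
Qed.

Lemma lebintZ (R : realType) (n : nat) (c : R) (F : n.-tuple R -> \bar R) : 0 <= c ->
  (forall t, 0 <= F t)%E -> measurable_fun setT F ->
  lebint (fun t => c%:E * F t)%E = (c%:E * lebint F)%E.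
Proof.
move=> c0 F0 mF; have [mu muE] := lebint_measure R n.
rewrite !muE//; first by rewrite ge0_integralZl.
- by move=> t; rewrite mule_ge0.
- exact: measurable_funeM.
Qed.

Lemma lebintD (R : realType) (n : nat) (F G : n.-tuple R -> \bar R) :
  (forall t, 0 <= F t)%E -> measurable_fun setT F ->
  (forall t, 0 <= G t)%E -> measurable_fun setT G ->
  lebint (fun t => F t + G t)%E = (lebint F + lebint G)%E.
Proof.
move=> F0 mF G0 mG; have [mu muE] := lebint_measure R n.
rewrite !muE//; first by rewrite ge0_integralD.
- by move=> t; rewrite adde_ge0.
- exact: emeasurable_funD.
Qed.

Lemma posdefZ (R : realType) (n : nat) (c : R) (A : 'M[R]_n) :
  0 < c -> posdef A -> posdef (c *: A).
Proof.
move=> c0 [As Ap]; split; first by rewrite linearZ/= As.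
by move=> v /Ap Av; rewrite qform_scale mulr_gt0.
Qed.

Lemma posdef1 (R : realType) (n : nat) : posdef (1%:M : 'M[R]_n).
Proof. by split; [exact: trmx1|move=> v; rewrite -sqn_gt0]. Qed.

Lemma lebint_gauss_iso (R : realType) (n : nat) (c : R) (mu : 'cV[R]_n) : 0 < c ->
  lebint (fun t => (expR (- (c * sqn (tcol t - mu)) / 2))%:E) =
  (Num.sqrt ((2 * pi) ^+ n / c ^+ n))%:E.
Proof.
move=> c0; have := lebint_gauss mu (posdefZ c0 (posdef1 R n)).
rewrite detZ det1 mulr1 => <-; congr lebint; apply/funext => t.
by rewrite qform_scale.
Qed.

Lemma sqnD_le (R : realType) (n : nat) (a b : 'cV[R]_n) :
  sqn (a + b) <= 2 * sqn a + 2 * sqn b.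
Proof.
have := sqn_ge0 (a - b); rewrite /sqn !qform_shift ?trmx1// linearN/= mulNmx mxE.
have -> : qform 1%:M (- b) = qform 1%:M b by rewrite -scaleN1r qformZ sqrrN expr1n mul1r.
lra.
Qed.

(** * The mixture is large when the error of a block is large *)

Section mixture_lower_bound.
Context (R : realType) (m d : nat) (b0 : 'cV[R]_(m * d)) (s : R).
Hypotheses (d0 : (0 < d)%N) (s0 : 0 < s).

(** With [th] the error of block [i] and [A] its information matrix, [Iblock_ols] gives the log
    ratio as [2 u.A th - u.A u] over [2 s^2]; the square is then completed around [th]. *)
Lemma mixture_integrand (i : 'I_m) (h : seq ((m * d).-tuple R * R)) (u : d.-tuple R) :
  (forall z, z \in h -> in_blocks z.1) -> gram h \in unitmx ->
  expR (- sqn (tcol u) / (2 * s ^+ 2)) *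
    \prod_(z <- h) lrat b0 s (blkmx R d i) u z =
  expR ((- sqn (tcol u) + qform (Iblock i h) (blk i (ols h - b0)) -
         qform (Iblock i h) (tcol u - blk i (ols h - b0))) / (2 * s ^+ 2)).
Proof.
move=> hb Vu; rewrite /lrat -expR_sum -expRD; congr expR.
rewrite -mulr_suml -mulrDl; congr (_ / _); rewrite -addrA; congr (_ + _).
set th := blk i _; set A := Iblock i h.
have -> : tcol u - th = - th + tcol u by rewrite addrC.
rewrite qform_shift; last exact: Iblock_sym.
have -> : qform A (- th) = qform A th by rewrite -scaleN1r qformZ sqrrN expr1n mul1r.
rewrite mulmxN Iblock_ols// mulmxN; set v := \col_l _.
have -> : (- ((tcol u)^T *m v)) 0 0 = - ((tcol u)^T *m v) 0 0 by rewrite mxE.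
have -> : ((tcol u)^T *m v) 0 0 = \sum_(z <- h) (z.2 - dotv z.1 b0) * tdot i z.1 (tcol u).
  rewrite mxE; under eq_bigr do rewrite !mxE mulr_sumr.
  rewrite exchange_big/=; apply: eq_bigr => z _; rewrite tdotE mulr_sumr.
  by apply: eq_bigr => l _; rewrite mxE; lra.
rewrite (qform_Iblock i h (tcol u)).
have -> : \sum_(z <- h) ((z.2 - dotv z.1 b0) ^+ 2 -
      (z.2 - dotv z.1 (b0 + blkmx R d i *m tcol u)) ^+ 2) =
    (\sum_(z <- h) (z.2 - dotv z.1 b0) * tdot i z.1 (tcol u)) *+ 2 -
    \sum_(z <- h) tdot i z.1 (tcol u) ^+ 2.
  rewrite -sumrMnl -sumrB; apply: eq_bigr => z _.
  by rewrite dotvD dotv_blkmx; lra.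
by rewrite mulNrn; lra.
Qed.

(** In [mixture_integrand], [A] is replaced by its extreme eigenvalues and [|u|^2] by
    [2 |th|^2 + 2 |u - th|^2]. What remains is a constant times an isotropic Gaussian centred at
    [th]; both constants 2 come from the latter bound. *)
Lemma mixture_lower (i : 'I_m) (h : seq ((m * d).-tuple R * R)) :
  (forall z, z \in h -> in_blocks z.1) -> gram h \in unitmx ->
  0 <= lambda_max (Iblock i h) ->
  ((expR ((lambda_min (Iblock i h) - 2) * sqn (blk i (ols h - b0)) / (2 * s ^+ 2)) *
    Num.sqrt ((2 * pi) ^+ d / ((2 + lambda_max (Iblock i h)) / s ^+ 2) ^+ d))%:E
   <= mixture b0 s (blkmx R d i) h)%E.
Proof.
move=> hb Vu L0; set th := blk i _; set A := Iblock i h in L0 *.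
set l := lambda_min A; set L := lambda_max A in L0 *.
have c0 : 0 < (2 + L) / s ^+ 2 by rewrite divr_gt0 ?exprn_gt0// ltr_wpDr.
rewrite EFinM -(lebint_gauss_iso th c0) -lebintZ ?expR_ge0//; last first.
  apply/measurable_EFinP/measurableT_comp => //.
  apply: measurable_funM => //; apply: measurableT_comp => //.
  apply: measurable_funM => //.
  by apply: measurable_qform => //= k; exact: measurable_tcol.
apply: lebint_le => u; first by rewrite mule_ge0// lee_fin expR_ge0.
rewrite mixture_integrand// -EFinM lee_fin -expRD ler_expR.
rewrite -/th -/A.
have As : A^T = A by exact: Iblock_sym.
have H1 := lambda_min_le th d0 As.
have H2 := lambda_max_ge (tcol u - th) d0 As.
have H3 : sqn (tcol u) <= 2 * sqn th + 2 * sqn (tcol u - th).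
  by have := sqnD_le th (tcol u - th); rewrite addrCA subrr addr0.
have -> : - ((2 + L) / s ^+ 2 * sqn (tcol u - th)) / 2 =
    (- ((2 + L) * sqn (tcol u - th))) / (2 * s ^+ 2).
  by rewrite invfM; lra.
rewrite -mulrDl ler_pM2r ?invr_gt0 ?mulr_gt0 ?exprn_gt0//.
rewrite -/l in H1; rewrite -/L in H2.
by rewrite mulrBl mulrDl; lra.
Qed.

Lemma mixture_nil (i : 'I_m) :
  mixture b0 s (blkmx R d i) [::] = (Num.sqrt ((2 * pi) ^+ d * s ^+ 2 ^+ d))%:E.
Proof.
have c0 : 0 < s ^- 2 by rewrite invr_gt0 exprn_gt0.
have -> : (2 * pi) ^+ d * s ^+ 2 ^+ d = (2 * pi) ^+ d / (s ^- 2) ^+ d :> R.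
  by rewrite exprVn invrK.
rewrite -(lebint_gauss_iso (0 : 'cV[R]_d) c0); congr lebint; apply/funext => u.
rewrite big_nil mulr1 subr0; congr (expR _)%:E.
by rewrite invfM; lra.
Qed.

End mixture_lower_bound.

(** Matrix balls are coordinatewise, and each coordinate is bounded by the Euclidean norm. Halving
    the radius [e] turns the large inequality into the strict one required by a ball. *)
Lemma continuous_sqnP (R : realType) (n : nat) (f : 'cV[R]_n -> R) (b : 'cV[R]_n) (eta : R) :
  {for b, continuous f} -> 0 < eta ->
  exists2 del, 0 < del & forall c, sqn (c - b) <= del -> `|f c - f b| <= eta.
Proof.
move=> cf eta0; have /cvgrPdist_le/(_ _ eta0)/nbhs_ballP[e /= e0 He] := cf.
exists ((e / 2) ^+ 2); first by rewrite exprn_gt0// divr_gt0.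
move=> c Hc; rewrite distrC; apply: He; split => // i j; rewrite ord1 /ball/=.
have : `|b i 0 - c i 0| ^+ 2 <= (e / 2) ^+ 2.
  apply: le_trans Hc; rewrite sqnE (bigD1 i)//= !mxE real_normK ?num_real//.
  rewrite -sqrrN opprB lerDl sumr_ge0// => k _; exact: sqr_ge0.
rewrite ler_sqr ?nnegrE//; last by rewrite divr_ge0// ltW.
move=> /le_lt_trans; apply.
by rewrite ltr_pdivrMr// ltr_pMr// ltr1n.
Qed.

Section gauss_pdf.
Context (R : realType) (p : nat) (W : 'M[R]_p) (mu : 'cV[R]_p).
Hypothesis pdW : posdef W.

Definition gnorm : R := Num.sqrt ((2 * pi) ^+ p / \det W).

Lemma gnorm_gt0 : 0 < gnorm.
Proof.
by rewrite sqrtr_gt0 divr_gt0 ?posdef_det_gt0// exprn_gt0// mulr_gt0// pi_gt0.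
Qed.

Lemma mvn_pdf_inv (b : 'cV[R]_p) :
  mvn_pdf mu (invmx W) b = gnorm^-1 * expR (- qform W (b - mu) / 2).
Proof. by rewrite /mvn_pdf invmxK det_inv. Qed.

Lemma measurable_gauss (c : R) : measurable_fun setT
  (fun t : p.-tuple R => expR (- (c * qform W (tcol t - mu)) / 2)).
Proof.
apply: measurableT_comp => //.
apply: measurable_funM => //; apply: measurableT_comp => //.
apply: measurable_funM => //.
by apply: measurable_qform => //= k; exact: measurable_tcol.
Qed.

(** The case [c = 1] normalises the density; [c = 1/2] gives the mass of the tail bound, where half
    of the exponent is kept. *)
Lemma lebint_gaussZ (c : R) : 0 < c ->
  lebint (fun t : p.-tuple R =>
    (gnorm^-1 * expR (- (c * qform W (tcol t - mu)) / 2))%:E) =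
  ((Num.sqrt (c ^+ p))^-1)%:E.
Proof.
move=> c0; under [X in lebint X]funext do rewrite EFinM.
have gi : 0 <= gnorm^-1 by rewrite invr_ge0 ltW// gnorm_gt0.
have mgc : measurable_fun [set: p.-tuple R]
    (fun t => (expR (- (c * qform W (tcol t - mu)) / 2))%:E).
  by apply/measurable_EFinP; exact: measurable_gauss.
rewrite lebintZ//.
under [X in lebint X]funext do rewrite -qform_scale.
rewrite lebint_gauss; last exact: posdefZ.
rewrite detZ -EFinM; congr (_%:E).
have D0 := posdef_det_gt0 pdW.
have -> : (2 * pi) ^+ p / (c ^+ p * \det W) = (2 * pi) ^+ p / \det W * (c ^+ p)^-1.
  by rewrite invfM; lra.
rewrite sqrtrM; last by rewrite divr_ge0 ?exprn_ge0 ?mulr_ge0 ?pi_ge0// ltW.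
by rewrite -/gnorm mulKf ?gt_eqF ?gnorm_gt0// sqrtrV// exprn_ge0// ltW.
Qed.

Lemma lebint_mvn : lebint (fun t : p.-tuple R => (mvn_pdf mu (invmx W) (tcol t))%:E) = 1%E.
Proof.
have := lebint_gaussZ ltr01; rewrite expr1n sqrtr1 invr1 => <-.
by congr lebint; apply/funext => t; rewrite mvn_pdf_inv mul1r.
Qed.

End gauss_pdf.

(** * Comparison of the posterior with its Gaussian factor *)

Section tv_bound.
Context (R : realType) (p : nat) (W : 'M[R]_p) (mu b0 : 'cV[R]_p) (prior : 'cV[R]_p -> R).
Context (M eta del lam : R).
Hypotheses (pdW : posdef W) (cprior : continuous prior).
Hypotheses (prior_bnd : forall b, 0 <= prior b <= M) (prior_gt0 : 0 < prior b0).
Hypotheses (eta0 : 0 < eta) (lam0 : 0 < lam).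
Hypothesis prior_near : forall b, sqn (b - b0) <= del -> `|prior b - prior b0| <= eta.
Hypothesis Wlam : forall v, lam * sqn v <= qform W v.
Hypothesis mu_near : sqn (mu - b0) <= del / 4.

Let g := mvn_pdf mu (invmx W).
Let tail (b : 'cV[R]_p) : R := (gnorm W)^-1 * expR (- (2^-1 * qform W (b - mu)) / 2).

(* The value of the bound on the integral of [|prior - prior b0| * g]: [eta] near [b0],
   and far from [b0] half of the exponent of [g] is spent to gain [exp (- lam del / 16)]. *)
Definition tv_kappa : R := eta + M * expR (- (lam * del) / 16) * (Num.sqrt (2^-1 ^+ p))^-1.

Let M0 : 0 <= M.
Proof. by have /andP[a b] := prior_bnd b0; exact: le_trans b. Qed.

Let g0 b : 0 <= g b.
Proof. by rewrite /g mvn_pdf_inv mulr_ge0 ?expR_ge0// invr_ge0 ltW// gnorm_gt0. Qed.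

Let tail0 b : 0 <= tail b.
Proof. by rewrite mulr_ge0 ?expR_ge0// invr_ge0 ltW// gnorm_gt0. Qed.

Let K := M * expR (- (lam * del) / 16).

Let K0 : 0 <= K. Proof. by rewrite mulr_ge0// expR_ge0. Qed.

(** Near [b0] the first term suffices. Far from it, [sqn (b - b0) <= 2 sqn (b - mu) + del / 2]
    forces [sqn (b - mu) >= del / 4], so half of the exponent of [g] is at most [- lam del / 16]. *)
Lemma prior_diff_bound b : `|prior b - prior b0| * g b <= eta * g b + K * tail b.
Proof.
have [near|far] := leP (sqn (b - b0)) del.
  apply: (@le_trans _ _ (eta * g b)); first by rewrite ler_wpM2r// prior_near.
  by rewrite lerDl mulr_ge0.
have pM : `|prior b - prior b0| <= M.
  have /andP[p1 p2] := prior_bnd b; have /andP[p3 p4] := prior_bnd b0.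
  by rewrite ler_norml; apply/andP; split; lra.
apply: (@le_trans _ _ (K * tail b)); last by rewrite lerDr mulr_ge0// ltW.
apply: (@le_trans _ _ (M * g b)); first by rewrite ler_wpM2r.
rewrite /K -mulrA ler_wpM2l// /g mvn_pdf_inv /tail mulrCA.
have gi : 0 <= (gnorm W)^-1 by rewrite invr_ge0 ltW// gnorm_gt0.
rewrite ler_wpM2l// -expRD ler_expR.
have far' : del / 4 <= sqn (b - mu).
  have := sqnD_le (b - mu) (mu - b0); rewrite addrA subrK.
  by move: far mu_near; lra.
have := Wlam (b - mu).
have : lam * (del / 4) <= lam * sqn (b - mu) by rewrite ler_pM2l.
lra.
Qed.

Let mg : measurable_fun setT (fun t : p.-tuple R => g (tcol t)).
Proof.
rewrite /g; under eq_fun do rewrite mvn_pdf_inv; apply: measurable_funM => //.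
have := measurable_gauss W mu 1.
by under eq_fun do rewrite mul1r.
Qed.

Let mtail : measurable_fun setT (fun t : p.-tuple R => tail (tcol t)).
Proof. by apply: measurable_funM => //; exact: measurable_gauss. Qed.

Let mprior : measurable_fun setT (fun t : p.-tuple R => prior (tcol t)).
Proof. exact: continuous_measurable_tcol. Qed.

Lemma lebint_error :
  lebint (fun t : p.-tuple R => (eta * g (tcol t) + K * tail (tcol t))%:E) = tv_kappa%:E.
Proof.
under [X in lebint X]funext do rewrite EFinD !EFinM.
have h1 : measurable_fun [set: p.-tuple R] (fun t => (g (tcol t))%:E) by exact/measurable_EFinP.
have h2 : measurable_fun [set: p.-tuple R] (fun t => (tail (tcol t))%:E) by exact/measurable_EFinP.
have k1 t : (0 <= eta%:E * (g (tcol t))%:E)%E by rewrite -EFinM lee_fin mulr_ge0// ltW.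
have k2 t : (0 <= K%:E * (tail (tcol t))%:E)%E by rewrite -EFinM lee_fin mulr_ge0.
rewrite lebintD//; try exact: measurable_funeM.
have l1 t : (0 <= (g (tcol t))%:E)%E by rewrite lee_fin.
have l2 t : (0 <= (tail (tcol t))%:E)%E by rewrite lee_fin.
rewrite (lebintZ (ltW eta0))// (lebintZ K0)//.
by rewrite lebint_mvn// lebint_gaussZ ?invr_gt0// mule1.
Qed.

(** Masses of [A] under [prior * g] and under [g]; [gintE] and [wintE] show that they are finite, so
    [fine] loses nothing. *)
Let wint (A : set (p.-tuple R)) : R :=
  fine (lebint (fun t => (\1_A t * (prior (tcol t) * g (tcol t)))%:E)).
Let gint (A : set (p.-tuple R)) : R := fine (lebint (fun t => (\1_A t * g (tcol t))%:E)).

Let pg0 b : 0 <= prior b * g b.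
Proof. by rewrite mulr_ge0//; have /andP[] := prior_bnd b. Qed.

Let gintE A : measurable A ->
  lebint (fun t => (\1_A t * g (tcol t))%:E) = (gint A)%:E /\ 0 <= gint A <= 1.
Proof.
move=> mA.
have H0 : (0 <= lebint (fun t => (\1_A t * g (tcol t))%:E))%E.
  by apply: lebint_ge0 => t; rewrite lee_fin mulr_ge0.
have H1 : (lebint (fun t => (\1_A t * g (tcol t))%:E) <= 1)%E.
  rewrite -(lebint_mvn mu pdW); apply: lebint_le => t.
    by rewrite lee_fin mulr_ge0.
  by rewrite lee_fin ler_piMl// indic_le1.
have fin : lebint (fun t => (\1_A t * g (tcol t))%:E) \is a fin_num.
  by rewrite ge0_fin_numE// (le_lt_trans H1)// ltry.
by rewrite /gint fineK// -!lee_fin fineK// H0 H1.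
Qed.

(** The pointwise bound is integrated over [A], but its error term over the whole space, so that
    [tv_kappa] is uniform in [A]. *)
Let wintE A : measurable A ->
  lebint (fun t => (\1_A t * (prior (tcol t) * g (tcol t)))%:E) = (wint A)%:E /\
  [/\ 0 <= wint A, wint A <= prior b0 * gint A + tv_kappa &
      prior b0 * gint A <= wint A + tv_kappa].
Proof.
move=> mA.
have m1 : measurable_fun [set: p.-tuple R] (fun t => (\1_A t * g (tcol t))%:E).
  by apply/measurable_EFinP; apply: measurable_funM.
have m2 : measurable_fun [set: p.-tuple R]
    (fun t => (\1_A t * (prior (tcol t) * g (tcol t)))%:E).
  by apply/measurable_EFinP; apply: measurable_funM => //; apply: measurable_funM.
have m3 : measurable_fun [set: p.-tuple R]
    (fun t => (eta * g (tcol t) + K * tail (tcol t))%:E).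
  by apply/measurable_EFinP; apply: measurable_funD; apply: measurable_funM.
have e0 t : (0 <= (eta * g (tcol t) + K * tail (tcol t))%:E)%E.
  by rewrite lee_fin addr_ge0// mulr_ge0// ltW.
have i0 t : (0 <= (\1_A t * g (tcol t))%:E)%E by rewrite lee_fin mulr_ge0.
have w0 t : (0 <= (\1_A t * (prior (tcol t) * g (tcol t)))%:E)%E.
  by rewrite lee_fin mulr_ge0.
have [gE _] := gintE mA.
have pr0 : 0 <= prior b0 by exact: ltW.
have bnd t : \1_A t * (prior (tcol t) * g (tcol t)) <=
      prior b0 * (\1_A t * g (tcol t)) + (eta * g (tcol t) + K * tail (tcol t)) /\
    prior b0 * (\1_A t * g (tcol t)) <=
      \1_A t * (prior (tcol t) * g (tcol t)) + (eta * g (tcol t) + K * tail (tcol t)).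
  have := prior_diff_bound (tcol t).
  have q1 := ler_norm (prior (tcol t) - prior b0).
  have q2 := ler_norm (- (prior (tcol t) - prior b0)); rewrite normrN in q2.
  have := e0 t; rewrite lee_fin.
  have G0 := g0 (tcol t).
  rewrite indicE; case: (_ \in _) => /=; rewrite ?mul1r ?mul0r ?mulr0 => E0 H.
    have a1 := ler_wpM2r G0 q1; have a2 := ler_wpM2r G0 q2; split; nra.
  by split; lra.
have U1 : (lebint (fun t => (\1_A t * (prior (tcol t) * g (tcol t)))%:E) <=
    (prior b0 * gint A + tv_kappa)%:E)%E.
  rewrite EFinD EFinM -gE -lebint_error -lebintZ// -lebintD//; last 2 first.
  - by move=> t; rewrite mule_ge0.
  - exact: measurable_funeM.
  by apply: lebint_le => t //; rewrite -EFinM -EFinD lee_fin; have [] := bnd t.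
have W0 : (0 <= lebint (fun t => (\1_A t * (prior (tcol t) * g (tcol t)))%:E))%E.
  exact: lebint_ge0.
have fin : lebint (fun t => (\1_A t * (prior (tcol t) * g (tcol t)))%:E) \is a fin_num.
  by rewrite ge0_fin_numE// (le_lt_trans U1)// ltry.
have wE : lebint (fun t => (\1_A t * (prior (tcol t) * g (tcol t)))%:E) = (wint A)%:E.
  by rewrite /wint fineK.
split=> //; rewrite wE !lee_fin in U1 W0; split=> //.
rewrite -lee_fin EFinD EFinM -gE -wE -lebint_error -lebintZ// -lebintD//.
apply: lebint_le => t; first by rewrite mule_ge0.
by rewrite -EFinM -EFinD lee_fin; have [] := bnd t.
Qed.

(** The factor [c] cancels, leaving [wint A / w - gint A]. Both [wint A] and [w gint A] are within
    [tv_kappa] of [prior b0 * gint A], and [w >= prior b0 - tv_kappa]. *)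
Lemma tvdist_bound (c : R) : 0 < c -> tv_kappa < prior b0 ->
  (tvdist (fun b => (prior b * (c * g b) /
             fine (lebint (fun t : p.-tuple R => (prior (tcol t) * (c * g (tcol t)))%:E)))%R) g
   <= (2 * tv_kappa / (prior b0 - tv_kappa))%:E)%E.
Proof.
move=> c0 kp; pose w := wint setT.
have [wE [w0 w1 w2]] := wintE (@measurableT _ (p.-tuple R)).
have gT : gint setT = 1.
  rewrite /gint (_ : lebint _ = 1%E)//; rewrite -(lebint_mvn mu pdW).
  by congr lebint; apply/funext => t; rewrite indicT mul1r.
rewrite gT mulr1 -/w in w1 w2; rewrite -/w in w0.
have wgt0 : 0 < w by lra.
have kp0 : 0 <= tv_kappa.
  rewrite -lee_fin -lebint_error; apply: lebint_ge0 => t.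
  by rewrite lee_fin addr_ge0// mulr_ge0// ltW.
have ZE : fine (lebint (fun t : p.-tuple R => (prior (tcol t) * (c * g (tcol t)))%:E)) = c * w.
  have -> : (fun t : p.-tuple R => (prior (tcol t) * (c * g (tcol t)))%:E) =
      (fun t => c%:E * (\1_setT t * (prior (tcol t) * g (tcol t)))%:E)%E.
    by apply/funext => t; rewrite indicT mul1r -EFinM; congr (_%:E); lra.
  rewrite lebintZ ?(ltW c0)//.
  - by rewrite wE -EFinM.
  - by move=> t; rewrite lee_fin indicT mul1r.
  - apply/measurable_EFinP; apply: measurable_funM => //; exact: measurable_funM.
rewrite ZE; apply: ub_ereal_sup => _ [A mA <-].
have [gE /andP[gA0 gA1]] := gintE mA.
have [wAE [wA0 wA1 wA2]] := wintE mA.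
have -> : lebint (fun t => (\1_A t * (prior (tcol t) * (c * g (tcol t)) / (c * w)))%:E) =
    (w^-1 * wint A)%:E.
  rewrite EFinM -wAE -lebintZ ?invr_ge0//.
  - congr lebint; apply/funext => t; rewrite -EFinM; congr (_%:E).
    by rewrite [prior _ * (c * _)]mulrCA -mulf_div divff ?gt_eqF// mul1r; lra.
  - by move=> t; rewrite lee_fin mulr_ge0.
  - apply/measurable_EFinP; apply: measurable_funM => //; exact: measurable_funM.
rewrite gE -EFinB abse_EFin lee_fin.
have -> : w^-1 * wint A - gint A = (wint A - w * gint A) / w.
  by rewrite mulrBl (mulrAC w) divff ?gt_eqF// mul1r mulrC.
rewrite normrM [`|w^-1|]gtr0_norm ?invr_gt0// ler_pdivrMr//.
have d0 : 0 < prior b0 - tv_kappa by lra.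
have N : `|wint A - w * gint A| <= 2 * tv_kappa.
  by rewrite ler_norml; apply/andP; split; nra.
apply: (le_trans N); rewrite [leRHS]mulrAC ler_pdivlMr// ler_wpM2l//; last lra.
by rewrite mulr_ge0.
Qed.

End tv_bound.

(** * Consistency and conclusion *)

Lemma cvge0_near (R : realType) (u : nat -> \bar R) : (forall n, 0 <= u n)%E ->
  (forall e : R, 0 < e -> \forall n \near \oo, (u n <= e%:E)%E) -> u @ \oo --> 0%E.
Proof.
move=> u0 H; apply/fine_cvgP; split.
  near=> n; rewrite ge0_fin_numE//; apply: (@le_lt_trans _ _ 1%:E); last exact: ltry.
  by near: n; exact: H.
apply/cvgrPdist_le => e e0; near=> n.
have ue : (u n <= e%:E)%E by near: n; exact: H.
rewrite /= sub0r normrN ger0_norm ?fine_ge0// -lee_fin fineK// ge0_fin_numE//.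
exact: le_lt_trans ue (ltry _).
Unshelve. all: by end_near. Qed.

Lemma near_cvge0 (R : realType) (u : nat -> \bar R) (e : R) :
  u @ \oo --> 0%E -> 0 < e -> \forall n \near \oo, (u n <= e%:E)%E.
Proof.
move=> /fine_cvgP[fin cv] e0; near=> n.
have fn : u n \is a fin_num by near: n.
rewrite -(fineK fn) lee_fin; apply: le_trans (ler_norm _) _.
rewrite -normrN -sub0r; near: n.
by move/cvgrPdist_le : cv; exact.
Unshelve. all: by end_near. Qed.

(** From [expR (c M) >= 1 + c M], which exceeds [K / e] as soon as [M >= K / (e c)]. *)
Lemma expR_decay (R : realType) (c K e : R) : 0 < c -> 0 <= K -> 0 < e ->
  exists M0, forall M, M0 <= M -> K * expR (- (c * M)) <= e.
Proof.
move=> c0 K0 e0; exists (K / (e * c)) => M.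
rewrite ler_pdivrMr ?mulr_gt0// expRN => HM.
rewrite ler_pdivrMr ?expR_gt0//; apply: (le_trans HM).
have := expR_ge1Dx (c * M).
rewrite -(ler_pM2l e0); nra.
Qed.

Lemma sqrt_powV (R : realType) (L : R) (d : nat) : 0 < L ->
  Num.sqrt ((L ^+ d)^-1) = expR (- (d%:R * ln L / 2)).
Proof.
move=> L0; rewrite -(ger0_norm (expR_ge0 _)) -sqrtr_sqr; congr Num.sqrt.
rewrite expr2 -expRD -opprD -splitr expRN; congr (_^-1).
by rewrite mulrC expRM_natr lnK ?posrE.
Qed.

Section consistency.
Context (R : realType) (m d : nat) (b0 : 'cV[R]_(m * d)) (s M t0 : R).
Hypotheses (d0 : (0 < d)%N) (s0 : 0 < s) (M4 : 4 <= M) (t00 : 0 < t0).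
Implicit Type h : seq ((m * d).-tuple R * R).

(* The lower bound on [mixture] when the squared error of a block exceeds [t0] while
   [lambda_min > M]. *)
Definition mix_thr : R :=
  Num.sqrt ((2 * pi) ^+ d * (s ^+ 2 / 3) ^+ d) * expR (t0 / (8 * s ^+ 2) * M).

Lemma mix_thr_gt0 : 0 < mix_thr.
Proof.
rewrite mulr_gt0 ?expR_gt0// sqrtr_gt0 mulr_gt0 ?exprn_gt0//.
  by rewrite mulr_gt0// pi_gt0.
by rewrite divr_gt0// exprn_gt0.
Qed.

(** By contradiction: an error above [t0] would push the lower bound of [mixture_lower] up to
    [mix_thr]. *)
Lemma ols_block_near (i : 'I_m) h :
  (forall z, z \in h -> in_blocks z.1) -> gram h \in unitmx ->
  M < lambda_min (Iblock i h) ->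
  `|ln (lambda_max (Iblock i h))| <=
    t0 / (4 * s ^+ 2 * d%:R) * `|lambda_min (Iblock i h)| ->
  (mixture b0 s (blkmx R d i) h < mix_thr%:E)%E ->
  sqn (blk i (ols h - b0)) <= t0.
Proof.
move=> hb Vu; set A := Iblock i h; set l := lambda_min A; set L := lambda_max A.
move=> Ml lnL mix; rewrite leNgt; apply/negP => tgt.
set t := sqn _ in tgt.
have As : A^T = A by exact: Iblock_sym.
have lL : l <= L.
  have [[v v0 vE] _] := lambda_min_attained d0 As.
  have := lambda_max_ge v d0 As; rewrite vE ler_pM2r ?sqn_gt0//.
have l4 : 4 <= l by exact: le_trans (ltW Ml).
have l0 : 0 < l by exact: lt_le_trans l4.
have L4 : 4 <= L by exact: le_trans lL.
have L0 : 0 < L by exact: lt_le_trans L4.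
have := mixture_lower b0 d0 s0 hb Vu (ltW L0).
rewrite -/A -/l -/L -/t => /le_lt_trans/(_ mix); rewrite lte_fin ltNge => /negP; apply.
clearbody l L t.
have s2 : 0 < s ^+ 2 by rewrite exprn_gt0.
have dR : 0 < d%:R :> R by rewrite ltr0n.
have -> : (2 * pi) ^+ d / ((2 + L) / s ^+ 2) ^+ d =
    (2 * pi) ^+ d * (s ^+ 2 / (2 + L)) ^+ d by rewrite -exprVn invf_div.
(* The 3 comes from [2 + L <= 3 L]. As [l - 2 >= l / 2], the gain in the exponent is at least
   [2 (t0 l / (8 s^2))]; the loss [d ln L / 2] costs at most one such unit, and the other dominates
   [t0 M / (8 s^2)]. *)
apply: (@le_trans _ _ (Num.sqrt ((2 * pi) ^+ d * (s ^+ 2 / 3) ^+ d) *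
   expR (- (d%:R * ln L / 2)) * expR ((l - 2) * t / (2 * s ^+ 2)))).
  rewrite /mix_thr -[leRHS]mulrA ler_wpM2l ?sqrtr_ge0// -expRD ler_expR.
  rewrite (gtr0_norm l0) in lnL; have lnL' := le_trans (ler_norm _) lnL.
  have e1 : t0 / (8 * s ^+ 2) * M <= t0 / (8 * s ^+ 2) * l.
    by rewrite ler_wpM2l ?ltW// divr_gt0// mulr_gt0.
  have e2 : d%:R * ln L / 2 <= t0 / (8 * s ^+ 2) * l.
    have -> : t0 / (8 * s ^+ 2) * l = d%:R * (t0 / (4 * s ^+ 2 * d%:R) * l) / 2.
      have dd : d%:R / d%:R = 1 :> R by rewrite divff// gt_eqF.
      have := congr1 (fun x => x * (t0 * l * (s ^+ 2)^-1 / 8)) dd.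
      by rewrite /= !invfM; lra.
    by rewrite ler_wpM2r// ler_wpM2l// ltW.
  have e3 : t0 / (8 * s ^+ 2) * l * 2 <= (l - 2) * t / (2 * s ^+ 2).
    have -> : t0 / (8 * s ^+ 2) * l * 2 = (l / 2 * t0) / (2 * s ^+ 2).
      by rewrite !invfM; lra.
    rewrite ler_pM2r ?invr_gt0 ?mulr_gt0//.
    by apply: ler_pM; [lra|exact: ltW|lra|exact: ltW].
  lra.
have pp : 0 <= (2 * pi : R) ^+ d by rewrite exprn_ge0// mulr_ge0// pi_ge0.
rewrite [leRHS]mulrC ler_wpM2r ?expR_ge0// -sqrt_powV// -sqrtrM; last first.
  by rewrite mulr_ge0// exprn_ge0// divr_ge0// sqr_ge0.
have q0 : 0 <= s ^+ 2 / (2 + L) by rewrite divr_ge0 ?ltW// ltr_wpDr// ltW.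
rewrite ler_sqrt ?mulr_ge0 ?exprn_ge0//.
rewrite -mulrA ler_wpM2l// -exprVn -exprMn lerXn2r ?nnegrE//.
  by rewrite mulr_ge0 ?invr_ge0 ?ltW// divr_gt0.
rewrite -mulrA ler_pM2l// -invfM lef_pV2 ?posrE ?mulr_gt0//; lra.
by rewrite mulr_ge0// pi_ge0.
Qed.

Lemma ols_near h (del : R) : t0 = del / (4 * m%:R) -> (0 < m)%N ->
  (forall z, z \in h -> in_blocks z.1) -> gram h \in unitmx ->
  (forall i : 'I_m, M < lambda_min (Iblock i h)) ->
  (forall i : 'I_m, `|ln (lambda_max (Iblock i h))| <=
    t0 / (4 * s ^+ 2 * d%:R) * `|lambda_min (Iblock i h)|) ->
  (forall i : 'I_m, (mixture b0 s (blkmx R d i) h < mix_thr%:E)%E) ->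
  sqn (ols h - b0) <= del / 4.
Proof.
move=> t0E m0 hb Vu Hl HL Hm; rewrite sqn_blocks.
apply: (@le_trans _ _ (\sum_(i < m) t0)).
  by apply: ler_sum => i _; exact: ols_block_near.
rewrite sumr_const card_ord t0E -(mulr_natr _ m) le_eqVlt; apply/orP; left; apply/eqP.
have mm : m%:R / m%:R = 1 :> R by rewrite divff// pnatr_eq0 -lt0n.
have := congr1 (fun x => x * (del / 4)) mm.
by rewrite /= !invfM; lra.
Qed.

End consistency.

(** By [lik_ols] the likelihood is a constant times the Gaussian density of precision [W], so
    [tvdist_bound] applies with that constant as [c]. *)
Lemma posterior_tvdist (R : realType) (p : nat) (s : R) (b0 : 'cV[R]_p)
    (prior : 'cV[R]_p -> R) (Mp eta del lam : R) (h : seq (p.-tuple R * R)) :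
  0 < s -> continuous prior -> (forall b, 0 <= prior b <= Mp) -> 0 < prior b0 ->
  0 < eta -> 0 < lam ->
  (forall b, sqn (b - b0) <= del -> `|prior b - prior b0| <= eta) ->
  posdef (gram h) -> (forall v, lam * sqn v <= qform (gram h) v) ->
  sqn (ols h - b0) <= del / 4 -> tv_kappa p Mp eta del (lam / s ^+ 2) < prior b0 ->
  (tvdist (posterior prior s h)
    (mvn_pdf (ols h) (s ^+ 2 *: invmx ((Xmat h)^T *m Xmat h)))
   <= (2 * tv_kappa p Mp eta del (lam / s ^+ 2) /
       (prior b0 - tv_kappa p Mp eta del (lam / s ^+ 2)))%:E)%E.
Proof.
move=> s0 cp pb pb0 eta0 lam0 pn pd Vlam on kp.
have s2 : 0 < s ^+ 2 by rewrite exprn_gt0.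
have is2 : 0 < s ^- 2 by rewrite invr_gt0.
pose W := s ^- 2 *: gram h.
have pdW : posdef W by exact: posdefZ.
have Vu := posdef_unitmx pd; have Wu := posdef_unitmx pdW.
rewrite -/(gram h) (_ : s ^+ 2 *: invmx (gram h) = invmx W); last first.
  by rewrite invmxZ// invrK.
have Wlam v : lam / s ^+ 2 * sqn v <= qform W v.
  by rewrite qform_scale mulrAC mulrC ler_wpM2l// ltW.
pose c := lik s h (ols h) * gnorm W.
have c0 : 0 < c.
  by rewrite mulr_gt0 ?gnorm_gt0// /lik prodr_gt0// => z _; rewrite expR_gt0.
have likE b : lik s h b = c * mvn_pdf (ols h) (invmx W) b.
  rewrite (lik_ols s b Vu) mvn_pdf_inv// /c -mulrA mulVKf ?gt_eqF ?gnorm_gt0//.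
  by congr (_ * expR _); rewrite qform_scale invfM; lra.
have := @tvdist_bound R p W (ols h) b0 prior Mp eta del (lam / s ^+ 2)
  pdW cp pb pb0 eta0 (divr_gt0 lam0 s2) pn Wlam on c c0 kp.
congr (_ <= _)%E; congr tvdist; apply/funext => b; rewrite /posterior likE.
congr (_ / fine (lebint _)); apply/funext => t; by rewrite likE.
Qed.

(** * Measurability of the exceptional events *)

Lemma measurable_Iblock (R : realType) (m d n : nat) (i : 'I_m) (a b : 'I_d) :
  measurable_fun setT (fun h : hist R (m * d) n => Iblock i (tval h) a b).
Proof.
under eq_fun do rewrite /Iblock summxE big_tuple.
apply: measurable_sum => j; under eq_fun do rewrite mxE big_ord1 !mxE.
have mj k : measurable_fun setT
    (fun h : hist R (m * d) n => tnth (tnth h j).1 k).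
  apply: (measurableT_comp (measurable_tnth k)).
  exact: (measurableT_comp measurable_fst (measurable_tnth j)).
exact: measurable_funM.
Qed.

Lemma measurable_in_blocks (R : realType) (m d : nat) :
  measurable [set x : (m * d).-tuple R | in_blocks x].
Proof.
rewrite (_ : [set _ | _] = \big[setU/set0]_(i < m) \big[setI/setT]_(k < m * d)
    (if (k %/ d)%N != i then [set x : (m * d).-tuple R | tnth x k = 0] else setT)).
  apply: bigsetU_measurable => i _; apply: bigsetI_measurable => k _.
  case: ifP => // _; rewrite -[X in measurable X]setTI.
  exact: (measurable_tnth k measurableT (measurable_set1 (0 : R))).
rewrite -bigcup_seq; apply/seteqP; split => x /=.
  move=> [i Hi]; exists i; first exact: mem_index_enum.
  by rewrite -bigcap_seq => k _ /=; case: ifPn => // /Hi.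
move=> [i _]; rewrite -bigcap_seq => Hi; exists i => k ki.
by have := Hi k (mem_index_enum k); rewrite /= ki.
Qed.

Lemma measurable_all_in_blocks (R : realType) (m d n : nat) :
  measurable [set h : hist R (m * d) n | forall z, z \in tval h -> in_blocks z.1].
Proof.
rewrite (_ : [set _ | _] = \big[setI/setT]_(j < n)
    [set h : hist R (m * d) n | in_blocks (tnth h j).1]).
  apply: bigsetI_measurable => j _; rewrite -[X in measurable X]setTI.
  exact: (measurableT_comp measurable_fst (measurable_tnth j) measurableT
    (@measurable_in_blocks R m d)).
rewrite -bigcap_seq; apply/seteqP; split => h /=.
  by move=> H j _ /=; apply: H; exact: mem_tnth.
by move=> H z /tnthP[j ->]; exact: (H j (mem_index_enum j)).
Qed.

Lemma measurable_hist_indic (R : realType) (p n : nat) (E : set (seq (p.-tuple R * R))) :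
  measurable [set h : hist R p n | E (tval h)] ->
  measurable_fun setT (fun h : hist R p n => (\1_E (tval h))%:E : \bar R).
Proof. by move=> mE; apply/measurable_EFinP; exact: (measurable_indic mE). Qed.

Section hprob_theory.
Context (R : realType) (p : nat) (Lam : sampling_rule R p) (b0 : 'cV[R]_p) (s : R).

(** The two indicators sum to the constant 1, of expectation 1; measurability of [E] is what makes
    [hexp] additive here. *)
Lemma hprob_setC n (E : set (seq (p.-tuple R * R))) :
  measurable [set h : hist R p n | E (tval h)] ->
  hprob Lam b0 s n E = 1%E -> hprob Lam b0 s n (~` E) = 0%E.
Proof.
move=> mE E1.
have mC : measurable [set h : hist R p n | (~` E) (tval h)].
  by rewrite (_ : [set _ | _] = ~` [set h : hist R p n | E (tval h)])//; exact: measurableC.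
have i0 (F : set (seq (p.-tuple R * R))) l : (0 <= (\1_F l : R)%:E)%E by rewrite lee_fin.
have := hexpD Lam b0 s [tuple] (i0 E) (i0 (~` E)) (add0n n)
  (measurable_hist_indic mE) (measurable_hist_indic mC).
rewrite (_ : (fun l => (\1_E l)%:E + (\1_(~` E) l)%:E)%E = (fun=> 1%E)); last first.
  apply/funext => l; rewrite -EFinD !indicE in_setC.
  by case: (_ \in _); rewrite ?addr0 ?add0r.
rewrite hexp_cst1 -[hexp _ _ _ _ _ (fun h => (\1_E h)%:E)]/(hprob Lam b0 s n E) E1.
rewrite -/(hprob Lam b0 s n (~` E)).
have : (0 <= hprob Lam b0 s n (~` E))%E by exact: hexp_ge0.
case: (hprob Lam b0 s n (~` E)) => [r| |]//= _ [] /eqP.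
by rewrite -subr_eq0 opprD addrA subrr sub0r oppr_eq0 => /eqP ->.
Qed.

End hprob_theory.

(** * Union bound over the exceptional events *)

Section hprob_bound.
Context (R : realType) (m d : nat) (Lam : sampling_rule R (m * d)) (s : R)
  (b0 : 'cV[R]_(m * d)).
Hypotheses (d0 : (0 < d)%N) (s0 : 0 < s).
Hypothesis blocks_as : forall n : nat, hprob Lam b0 s n
  [set h | forall z, z \in h -> in_blocks z.1] = 1%E.

(** Union bound combined with Markov's inequality for the mixture. [E] may be nonmeasurable: its
    indicator is first dominated by a measurable sum, which is then integrated term by term. *)
Lemma hprob_bound (M t0 : R) (n : nat) (E : set (seq ((m * d).-tuple R * R))) :
  (forall h, E h ->
     [\/ ~ (forall z, z \in h -> in_blocks z.1),
         exists i : 'I_m, lambda_min (Iblock i h) <= M,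
         exists i : 'I_m, t0 / (4 * s ^+ 2 * d%:R) * `|lambda_min (Iblock i h)| <
            `|ln (lambda_max (Iblock i h))|
       | exists i : 'I_m, ((mix_thr d s M t0)%:E <= mixture b0 s (blkmx R d i) h)%E]) ->
  (hprob Lam b0 s n E <= \sum_(i < m)
     (hprob Lam b0 s n [set h | (lambda_min (Iblock i h) <= M)%R] +
      hprob Lam b0 s n
        [set h | (t0 / (4 * s ^+ 2 * d%:R) * `|lambda_min (Iblock i h)| <
         `|ln (lambda_max (Iblock i h))|)%R] +
      ((mix_thr d s M t0)^-1 * Num.sqrt ((2 * pi) ^+ d * s ^+ 2 ^+ d))%:E))%E.
Proof.
move=> HE; set thr := mix_thr d s M t0.
have thr0 : 0 < thr by exact: mix_thr_gt0.
pose N : set (seq ((m * d).-tuple R * R)) := [set h | forall z, z \in h -> in_blocks z.1].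
pose A (i : 'I_m) : set (seq ((m * d).-tuple R * R)) := [set h | lambda_min (Iblock i h) <= M].
pose B (i : 'I_m) : set (seq ((m * d).-tuple R * R)) :=
  [set h | t0 / (4 * s ^+ 2 * d%:R) * `|lambda_min (Iblock i h)| <
         `|ln (lambda_max (Iblock i h))|].
have ml i : measurable_fun setT
    (fun h : hist R (m * d) n => lambda_min (Iblock i (tval h))).
  apply: measurable_lambda_min => // [h|a b]; [exact: Iblock_sym|exact: measurable_Iblock].
have mL i : measurable_fun setT
    (fun h : hist R (m * d) n => lambda_max (Iblock i (tval h))).
  apply: measurable_lambda_max => // [h|a b]; [exact: Iblock_sym|exact: measurable_Iblock].
have mN : measurable [set h : hist R (m * d) n | N (tval h)].
  exact: measurable_all_in_blocks.
have mNC : measurable [set h : hist R (m * d) n | (~` N) (tval h)].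
  by rewrite (_ : [set _ | _] = ~` [set h : hist R (m * d) n | N (tval h)])//; exact: measurableC.
have mA i : measurable [set h : hist R (m * d) n | A i (tval h)].
  exact: (measurable_setler (ml i) (measurable_cst M)).
have mB i : measurable [set h : hist R (m * d) n | B i (tval h)].
  apply: (measurable_setltr (f := fun h : hist R (m * d) n =>
     t0 / (4 * s ^+ 2 * d%:R) * `|lambda_min (Iblock i (tval h))|)
     (g := fun h : hist R (m * d) n => `|ln (lambda_max (Iblock i (tval h)))|)).
    by apply: measurable_funM => //; apply: measurableT_comp.
  by apply: measurableT_comp => //; apply: measurableT_comp.
have iN := measurable_hist_indic mNC.
have iA i := measurable_hist_indic (mA i).
have iB i := measurable_hist_indic (mB i).
have i0 (F : set (seq ((m * d).-tuple R * R))) l : (0 <= (\1_F l : R)%:E)%E.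
  by rewrite lee_fin.
have x0 i l : (0 <= mixture b0 s (blkmx R d i) l)%E by exact: mixture_ge0.
have it0 : 0 <= thr^-1 by rewrite invr_ge0 ltW.
pose T i (l : seq ((m * d).-tuple R * R)) : \bar R :=
  ((\1_(A i) l)%:E + (\1_(B i) l)%:E + thr^-1%:E * mixture b0 s (blkmx R d i) l)%E.
have T0 i l : (0 <= T i l)%E by rewrite !adde_ge0// mule_ge0.
have mmix i : measurable_fun setT
    (fun h : hist R (m * d) n => mixture b0 s (blkmx R d i) (tval h)).
  exact: measurable_mixture.
have mcm i : measurable_fun setT (fun h : hist R (m * d) n =>
    thr^-1%:E * mixture b0 s (blkmx R d i) (tval h))%E.
  exact: measurable_funeM.
have mAB i : measurable_fun setT (fun h : hist R (m * d) n =>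
    (\1_(A i) (tval h) : R)%:E + (\1_(B i) (tval h) : R)%:E)%E.
  apply: emeasurable_funD; [exact: iA|exact: iB].
have mT i : measurable_fun setT (fun h : hist R (m * d) n => T i (tval h)).
  by apply: emeasurable_funD; [exact: mAB|exact: mcm].
apply: (@le_trans _ _ (hexp Lam b0 s n [tuple]
    (fun l => (\1_(~` N) l)%:E + \sum_(i <- index_enum 'I_m) T i l))%E).
  apply: hexp_le => // h _.
  have S0 : (0 <= \sum_(i <- index_enum 'I_m) T i h)%E by apply: sume_ge0.
  rewrite [X in (X%:E <= _)%E]indicE; case: (boolP (h \in E)) => [|_]; last first.
    by rewrite adde_ge0.
  rewrite inE => /HE[nN|[i Ai]|[i Bi]|[i mi]].
  - rewrite indicE mem_set//= leeDl//.
  - have : (1 <= T i h)%E.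
      rewrite /T indicE mem_set//= -addeA leeDl// adde_ge0// mule_ge0//.
    move=> /le_trans; apply; apply: (@le_trans _ _ (\sum_(i <- index_enum 'I_m) T i h)%E).
      by rewrite (bigD1_seq i) ?mem_index_enum ?index_enum_uniq//= leeDl// sume_ge0.
    by rewrite leeDr.
  - have : (1 <= T i h)%E.
      rewrite /T [\1_(B i) h]indicE mem_set//= addeAC leeDr// adde_ge0// mule_ge0//.
    move=> /le_trans; apply; apply: (@le_trans _ _ (\sum_(i <- index_enum 'I_m) T i h)%E).
      by rewrite (bigD1_seq i) ?mem_index_enum ?index_enum_uniq//= leeDl// sume_ge0.
    by rewrite leeDr.
  - have : (1 <= T i h)%E.
      (* Pointwise form of Markov's inequality: on this event the rescaled mixture is at least 1. *)
      apply: (@le_trans _ _ (thr^-1%:E * mixture b0 s (blkmx R d i) h)%E).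
        apply: (@le_trans _ _ (thr^-1%:E * thr%:E)%E).
          by rewrite -EFinM mulVf// gt_eqF.
        by rewrite lee_wpmul2l// lee_fin.
      by rewrite /T leeDr// adde_ge0.
    move=> /le_trans; apply; apply: (@le_trans _ _ (\sum_(i <- index_enum 'I_m) T i h)%E).
      by rewrite (bigD1_seq i) ?mem_index_enum ?index_enum_uniq//= leeDl// sume_ge0.
    by rewrite leeDr.
rewrite (hexpD _ _ _ _ _ _ (add0n n))//; last 2 first.
- by move=> l; apply: sume_ge0.
- exact: emeasurable_sum.
rewrite -/(hprob Lam b0 s n (~` N)) (hprob_setC mN)// add0e.
rewrite (hexp_sum _ _ _ _ _ _ (add0n n))//.
apply: lee_sum => i _.
rewrite (hexpD _ _ _ _ _ _ (add0n n))//; last 2 first.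
- by move=> l; rewrite adde_ge0.
- by move=> l; rewrite mule_ge0.
rewrite (hexpD _ _ _ _ _ _ (add0n n))//.
rewrite (hexpZ _ _ _ _ _ _ (add0n n))// hexp_mixture ?gt_eqF//.
by rewrite mixture_nil.
Qed.

End hprob_bound.

Unset Implicit Arguments.

Theorem theorem4 (R : realType) (m d : nat)
    (Lam : sampling_rule R (m * d)) (sigma : R) (beta0 : 'cV[R]_(m * d))
    (prior : 'cV[R]_(m * d) -> R) :
  (0 < m)%N -> (0 < d)%N -> 0 < sigma ->
  (* (i) each x_j lies in X (almost surely) *)
  (forall n : nat, hprob Lam beta0 sigma n
      [set h | forall z, z \in h -> in_blocks z.1] = 1%E) ->
  (* (ii) lambda_min(I_{n,i}) -->p oo and log lambda_max(I_{n,i}) = o_p(lambda_min(I_{n,i})) *)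
  (forall i : 'I_m,
     (forall M : R, vanishing_prob Lam beta0 sigma
        (fun n => [set h | lambda_min (Iblock i h) <= M])) /\
     (forall eps : R, 0 < eps -> vanishing_prob Lam beta0 sigma
        (fun n => [set h | eps * `|lambda_min (Iblock i h)|
                           < `|ln (lambda_max (Iblock i h))|]))) ->
  (* (iii) prior: continuous bounded density with prior(beta0) > 0 *)
  continuous prior ->
  (exists M : R, forall b, 0 <= prior b <= M) ->
  lebint (fun t => (prior (tcol t))%:E) = 1%E ->
  0 < prior beta0 ->
  forall eps : R, 0 < eps ->
  vanishing_prob Lam beta0 sigma
    (fun n => [set h | (eps%:E < tvdist (posterior prior sigma h)
        (mvn_pdf (ols h) (sigma ^+ 2 *: invmx ((Xmat h)^T *m Xmat h))))%E]).
Proof.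
move=> m0 d0 s0 blocks_as lam_cond cprior [Mp prior_bnd] _ prior0 eps eps0.
have s2 : 0 < sigma ^+ 2 by rewrite exprn_gt0.
have mR : 0 < m%:R :> R by rewrite ltr0n.
have dR : 0 < d%:R :> R by rewrite ltr0n.
have Mp0 : 0 <= Mp by have /andP[a b] := prior_bnd beta0; exact: le_trans b.
(* [k0] is the largest kappa with [2 * kappa / (prior beta0 - kappa) <= eps] *)
pose k0 := eps * prior beta0 / (2 + eps).
have e2 : 0 < 2 + eps by rewrite addr_gt0.
have k00 : 0 < k0 by rewrite divr_gt0// mulr_gt0.
have k0E : k0 * (2 + eps) = eps * prior beta0 by rewrite divfK// gt_eqF.
have k02 : 0 < k0 / 2 by rewrite divr_gt0.
(* Half of [k0] pays for the variation of the prior near [beta0], the other half for the Gaussian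
   tail, through [M1]. *)
have [del del0 Hdel] := continuous_sqnP (cprior beta0) k02.
(* Error allowed in each block, so that the [m] blocks add up to [del / 4]. *)
pose t0 : R := del / (4 * m%:R).
have t00 : 0 < t0 by rewrite divr_gt0// mulr_gt0.
have c10 : 0 < del / (16 * sigma ^+ 2) by rewrite divr_gt0// mulr_gt0.
have K10 : 0 <= Mp * (Num.sqrt (2^-1 ^+ (m * d)))^-1 by rewrite mulr_ge0// invr_ge0 sqrtr_ge0.
have [M1 HM1] := expR_decay c10 K10 k02.
apply: cvge0_near => [n|e e0]; first exact: hexp_ge0.
(* [C1] is the expectation of the mixture and [cd] the constant factor of [mix_thr]; their ratio
   governs the Markov term. *)
pose C1 : R := Num.sqrt ((2 * pi) ^+ d * sigma ^+ 2 ^+ d).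
pose cd : R := Num.sqrt ((2 * pi) ^+ d * (sigma ^+ 2 / 3) ^+ d).
have c20 : 0 < t0 / (8 * sigma ^+ 2) by rewrite divr_gt0// mulr_gt0.
have K20 : 0 <= C1 / cd by rewrite divr_ge0 ?sqrtr_ge0.
(* Each block receives [e / m]: half for the Markov term and a quarter for each of the two
   eigenvalue events. *)
have e2m : 0 < e / (2 * m%:R) by rewrite divr_gt0// mulr_gt0.
have e4m : 0 < e / (4 * m%:R) by rewrite divr_gt0// mulr_gt0.
have [M2 HM2] := expR_decay c20 K20 e2m.
(* The 4 is required by [ols_block_near], [M1] controls the Gaussian tail and [M2] the Markov
   term. *)
pose M := Num.max 4 (Num.max M1 M2).
have M4 : 4 <= M by rewrite le_max lexx.
have MM1 : M1 <= M by rewrite !le_max lexx orbT.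
have MM2 : M2 <= M by rewrite !le_max lexx !orbT.
have M0 : 0 < M by exact: lt_le_trans M4.
have eta0 : 0 < t0 / (4 * sigma ^+ 2 * d%:R) by rewrite divr_gt0// !mulr_gt0.
(* Deterministic core: outside the four exceptional events the total variation distance is at most
   [eps]. *)
have good h : (eps%:E < tvdist (posterior prior sigma h)
        (mvn_pdf (ols h) (sigma ^+ 2 *: invmx ((Xmat h)^T *m Xmat h))))%E ->
    [\/ ~ (forall z, z \in h -> in_blocks z.1),
         exists i : 'I_m, lambda_min (Iblock i h) <= M,
         exists i : 'I_m, t0 / (4 * sigma ^+ 2 * d%:R) * `|lambda_min (Iblock i h)| <
            `|ln (lambda_max (Iblock i h))|
       | exists i : 'I_m,
           ((mix_thr d sigma M t0)%:E <= mixture beta0 sigma (blkmx R d i) h)%E].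
  move=> Eh.
  have [hb|nb] := pselect (forall z, z \in h -> in_blocks z.1); last by constructor 1.
  have [A|/forallNP A] := pselect (exists i : 'I_m, lambda_min (Iblock i h) <= M).
    by constructor 2.
  have [B|/forallNP B] := pselect (exists i : 'I_m,
      t0 / (4 * sigma ^+ 2 * d%:R) * `|lambda_min (Iblock i h)| <
        `|ln (lambda_max (Iblock i h))|); first by constructor 3.
  have [D|/forallNP D] := pselect (exists i : 'I_m,
      ((mix_thr d sigma M t0)%:E <= mixture beta0 sigma (blkmx R d i) h)%E).
    by constructor 4.
  exfalso.
  have {}A i : M < lambda_min (Iblock i h) by rewrite ltNge; exact/negP/A.
  have {}B i : `|ln (lambda_max (Iblock i h))| <=
      t0 / (4 * sigma ^+ 2 * d%:R) * `|lambda_min (Iblock i h)|.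
    by rewrite leNgt; exact/negP/B.
  have {}D i : (mixture beta0 sigma (blkmx R d i) h < (mix_thr d sigma M t0)%:E)%E.
    by rewrite ltNge; exact/negP/D.
  have [pd Vlam] := gram_posdef hb d0 M0 (fun i => ltW (A i)).
  have near_ols := ols_near d0 s0 M4 t00 erefl m0 hb (posdef_unitmx pd) A B D.
  have kap : tv_kappa (m * d) Mp (k0 / 2) del (M / sigma ^+ 2) <= k0.
    rewrite /tv_kappa [leRHS]splitr lerD2l mulrAC.
    have -> : - (M / sigma ^+ 2 * del) / 16 = - (del / (16 * sigma ^+ 2) * M).
      by rewrite invfM; lra.
    exact: HM1.
  have kap_lt : tv_kappa (m * d) Mp (k0 / 2) del (M / sigma ^+ 2) < prior beta0.
    apply: (le_lt_trans kap); rewrite /k0 ltr_pdivrMr// mulrC ltr_pM2l// ltrDr.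
    by [].
  have := posterior_tvdist s0 cprior prior_bnd prior0 k02 M0 Hdel pd Vlam near_ols kap_lt.
  move=> /(lt_le_trans Eh); rewrite lte_fin ltNge => /negP; apply.
  rewrite ler_pdivrMr ?subr_gt0//.
  set k := tv_kappa _ _ _ _ _ in kap *.
  have : k * (2 + eps) <= k0 * (2 + eps) by rewrite ler_pM2r.
  by rewrite k0E; lra.
(* There are finitely many blocks, so one threshold on [n] serves them all. *)
have nearA : \forall n \near \oo, forall i : 'I_m,
    (hprob Lam beta0 sigma n [set h | (lambda_min (Iblock i h) <= M)%R] <= (e / (4 * m%:R))%:E)%E.
  by apply: filter_forall => i; exact: near_cvge0 ((lam_cond i).1 M) e4m.
have nearB : \forall n \near \oo, forall i : 'I_m,
    (hprob Lam beta0 sigma n [set h | (t0 / (4 * sigma ^+ 2 * d%:R) *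
       `|lambda_min (Iblock i h)| < `|ln (lambda_max (Iblock i h))|)%R] <=
     (e / (4 * m%:R))%:E)%E.
  by apply: filter_forall => i; exact: near_cvge0 ((lam_cond i).2 _ eta0) e4m.
near=> n.
apply: le_trans (hprob_bound d0 s0 blocks_as n good) _.
apply: (@le_trans _ _ (\sum_(i < m) (e / m%:R)%:E)%E); last first.
  rewrite sumEFin lee_fin sumr_const card_ord -(mulr_natr (e / m%:R)) divfK// gt_eqF//.
apply: lee_sum => i _.
have -> : e / m%:R = e / (4 * m%:R) + e / (4 * m%:R) + e / (2 * m%:R).
  by rewrite !invfM; lra.
rewrite !EFinD; apply: leeD; first apply: leeD.
- by move: i; near: n.
- by move: i; near: n.
rewrite lee_fin; apply: le_trans (HM2 _ MM2).
by rewrite /mix_thr invfM -/cd -/C1 -expRN mulrC mulrA.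
Unshelve. all: by end_near. Qed.
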